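(* Let $M\geq 2$ be an integer and let $q$ be a prime power with $(q,M)=1$. Then, as formal power series in $u$: (1) $$1+\sum_{n=1}^{\infty}\frac{|\mathrm{GL}(n,q)^M_{\mathrm{rs}}|}{|\mathrm{GL}(n,q)|}u^n=\prod_{d\geq 1}\left(1+\frac{u^d}{q^d-1}\right)^{N_M(q,d)}.$$ (2) $$1+\sum_{n=1}^{\infty}\frac{|\mathrm{GL}(n,q)^M_{\mathrm{rg}}|}{|\mathrm{GL}(n,q)|}u^n=\prod_{d\geq 1}\left(1+\sum_{j=1}^{\infty}\frac{u^{jd}}{q^{(j-1)d}(q^d-1)}\right)^{N_M(q,d)}=\prod_{d\geq 1}\left(1-\frac{u^d}{q^d}\right)^{-N_M(q,d)}\prod_{d\geq 1}\left(1+\frac{u^d}{q^d(q^d-1)}\right)^{N_M(q,d)}.$$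
   Context: $\mathbb F_q$ is the field with $q$ elements and $\mathrm{GL}(n,q)$ the group of invertible $n\times n$ matrices over it. $\Phi$ is the set of all monic irreducible polynomials of degree $\geq 1$ over $\mathbb F_q$ other than the polynomial $x$. The conjugacy class of $\alpha\in\mathrm{GL}(n,q)$ is determined by its combinatorial data: distinct $f_1,\dots,f_l\in\Phi$ with non-empty partitions $\lambda_{f_i}=(\lambda_{i_1},\lambda_{i_2},\dots)$ satisfying $\sum_i|\lambda_{f_i}|\deg f_i=n$, meaning that the $\mathbb F_q[x]$-module $\mathbb F_q^n$ defined by $\alpha$ is isomorphic to $\bigoplus_{i,j}\mathbb F_q[x]/(f_i^{\lambda_{i_j}})$. The element $\alpha$ is regular if every $\lambda_{f_i}$ has a single part, and regular semisimple if every $\lambda_{f_i}=(1)$. $\mathrm{GL}(n,q)^M_{\mathrm{rg}}$ (resp. $\mathrm{GL}(n,q)^M_{\mathrm{rs}}$) is the set of regular (resp. regular semisimple) elements of $\mathrm{GL}(n,q)$ lying in the image of the power map $\mathrm{GL}(n,q)\to\mathrm{GL}(n,q)$, $x\mapsto x^M$. A monic irreducible polynomial $f(x)\in\mathbb F_q[x]$ is an M-power polynomial if $f(x^M)$ has an irreducible factor of degree $\deg f$. $N_M(q,d)$ is the number of M-power polynomials of degree $d$ in $\Phi$. *)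

(* Defs.v *)
From HB Require Import structures.
From mathcomp Require Import all_boot all_order all_algebra all_fingroup all_field.
From mathcomp Require Import boolp classical_sets.

Set Implicit Arguments.
Unset Strict Implicit.
Unset Printing Implicit Defensive.

Import GRing.Theory.
Local Open Scope ring_scope.

Record fps (R : Type) := Fps { fps_coef :> nat -> R }.
Notation "{ 'fps' R }" := (fps R) (at level 0, format "{ 'fps'  R }").

HB.instance Definition _ (R : Type) := gen_eqMixin {fps R}.
HB.instance Definition _ (R : Type) := gen_choiceMixin {fps R}.

Lemma fpsP (R : Type) (f g : {fps R}) : (forall n, f n = g n) -> f = g.
Proof. by case: f g => f [g] /= /funext ->. Qed.

Section FpsRing.
Variable R : fieldType.
Implicit Types (f g h : {fps R}) (a b : R).

Definition fps_zero : {fps R} := Fps (fun=> 0).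
Definition fps_opp f : {fps R} := Fps (fun n => - f n).
Definition fps_add f g : {fps R} := Fps (fun n => f n + g n).

Fact fps_addA : associative fps_add.
Proof. by move=> f g h; apply: fpsP => n /=; rewrite addrA. Qed.
Fact fps_addC : commutative fps_add.
Proof. by move=> f g; apply: fpsP => n /=; rewrite addrC. Qed.
Fact fps_add0 : left_id fps_zero fps_add.
Proof. by move=> f; apply: fpsP => n /=; rewrite add0r. Qed.
Fact fps_addN : left_inverse fps_zero fps_opp fps_add.
Proof. by move=> f; apply: fpsP => n /=; rewrite addNr. Qed.

HB.instance Definition _ := GRing.isZmodule.Build {fps R}
  fps_addA fps_addC fps_add0 fps_addN.

Definition fps_one : {fps R} := Fps (fun n => (n == 0)%:R).
Definition fps_mul f g : {fps R} :=
  Fps (fun n => \sum_(i < n.+1) f i * g (n - i)%N).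

(* Truncation to a polynomial, through which the ring laws are inherited from
   those of {poly R}. *)
Definition fps_trunc N f : {poly R} := \poly_(i < N) f i.

Fact fps_mul_trunc f g n N : (n < N)%N ->
  fps_mul f g n = (fps_trunc N f * fps_trunc N g)`_n.
Proof.
move=> ltnN; rewrite coefM /=; apply: eq_bigr => i _; rewrite !coef_poly.
by rewrite (leq_ltn_trans (leq_subr _ _) ltnN) (leq_ltn_trans _ ltnN) // -ltnS.
Qed.

Fact coef_mul_eq (p p' r r' : {poly R}) n :
  (forall i, (i <= n)%N -> p`_i = p'`_i) ->
  (forall i, (i <= n)%N -> r`_i = r'`_i) -> (p * r)`_n = (p' * r')`_n.
Proof.
move=> eqp eqr; rewrite !coefM; apply: eq_bigr => i _.
by rewrite eqp -1?ltnS // eqr // leq_subr.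
Qed.

Fact coef_trunc_mul f g n N : (n < N)%N ->
  (fps_trunc N (fps_mul f g))`_n = (fps_trunc N f * fps_trunc N g)`_n.
Proof. by move=> ltnN; rewrite coef_poly ltnN -fps_mul_trunc. Qed.

Fact fps_mulA : associative fps_mul.
Proof.
move=> f g h; apply: fpsP => n; rewrite !(@fps_mul_trunc _ _ n n.+1) //.
transitivity (fps_trunc n.+1 f * (fps_trunc n.+1 g * fps_trunc n.+1 h))`_n.
  by apply: coef_mul_eq => // i lein; rewrite coef_trunc_mul.
by rewrite mulrA; apply: coef_mul_eq => // i lein; rewrite coef_trunc_mul.
Qed.
Fact fps_mulC : commutative fps_mul.
Proof.
by move=> f g; apply: fpsP => n; rewrite !(@fps_mul_trunc _ _ n n.+1) // mulrC.
Qed.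
Fact fps_mul1 : left_id fps_one fps_mul.
Proof.
move=> f; apply: fpsP => n /=; rewrite big_ord_recl mul1r subn0 big1 ?addr0 //.
by move=> i _; rewrite mul0r.
Qed.
Fact fps_mulD : left_distributive fps_mul fps_add.
Proof.
move=> f g h; apply: fpsP => n /=; rewrite -big_split /=.
by apply: eq_bigr => i _; rewrite mulrDl.
Qed.
Fact fps_one_neq0 : fps_one != 0 :> {fps R}.
Proof.
apply/eqP => /(congr1 (fun f : {fps R} => f 0%N)) /= /eqP.
by rewrite oner_eq0.
Qed.

HB.instance Definition _ := GRing.Zmodule_isComNzRing.Build {fps R}
  fps_mulA fps_mulC fps_mul1 fps_mulD fps_one_neq0.

Definition fps_scale a f : {fps R} := Fps (fun n => a * f n).

Fact fps_scaleA a b f : fps_scale a (fps_scale b f) = fps_scale (a * b) f.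
Proof. by apply: fpsP => n /=; rewrite mulrA. Qed.
Fact fps_scale1 : left_id 1 fps_scale.
Proof. by move=> f; apply: fpsP => n /=; rewrite mul1r. Qed.
Fact fps_scaleDr : right_distributive fps_scale +%R.
Proof. by move=> a f g; apply: fpsP => n /=; rewrite mulrDr. Qed.
Fact fps_scaleDl f : {morph fps_scale^~ f : a b / a + b}.
Proof. by move=> a b; apply: fpsP => n /=; rewrite mulrDl. Qed.

HB.instance Definition _ := GRing.Zmodule_isLmodule.Build R {fps R}
  fps_scaleA fps_scale1 fps_scaleDr fps_scaleDl.

Fact fps_scaleAl a f g : a *: (f * g) = (a *: f) * g.
Proof.
apply: fpsP => n /=; rewrite mulr_sumr.
by apply: eq_bigr => i _; rewrite mulrA.
Qed.

HB.instance Definition _ := GRing.Lmodule_isLalgebra.Build R {fps R} fps_scaleAl.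

Lemma fps0E n : (0 : {fps R}) n = 0. Proof. by []. Qed.
Lemma fps1E n : (1 : {fps R}) n = (n == 0)%:R. Proof. by []. Qed.
Lemma fpsDE f g n : (f + g) n = f n + g n. Proof. by []. Qed.
Lemma fpsNE f n : (- f) n = - f n. Proof. by []. Qed.
Lemma fpsZE a f n : (a *: f) n = a * f n. Proof. by []. Qed.
Lemma fpsME f g n : (f * g) n = \sum_(i < n.+1) f i * g (n - i)%N.
Proof. by []. Qed.
Lemma fps_sumE (I : Type) (r : seq I) (P : pred I) (F : I -> {fps R}) n :
  (\sum_(i <- r | P i) F i) n = \sum_(i <- r | P i) F i n.
Proof. by elim/big_rec2: _ => //= i _ f _ <-. Qed.

Lemma fpsX_small f k n : f 0%N = 0 -> (n < k)%N -> (f ^+ k) n = 0.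
Proof.
move=> f0; elim: k n => // k IHk n ltnk; rewrite exprS fpsME big_ord_recl f0.
rewrite mul0r add0r big1 // => i _; rewrite IHk ?mulr0 //= /bump /= add1n.
by rewrite (leq_trans _ (ltnSE ltnk)) // ltn_subrL /= (leq_ltn_trans _ (ltn_ord i)).
Qed.

(* f is invertible iff f(0) != 0, and then
   f^-1 = f(0)^-1 * \sum_k (1 - f(0)^-1 f)^k. *)
Definition fps_unit : pred {fps R} := fun f => f 0%N != 0.
Definition fps_inv f : {fps R} :=
  if fps_unit f then
    let h := 1 - (f 0%N)^-1 *: f in
    (f 0%N)^-1 *: Fps (fun n => (\sum_(k < n.+1) h ^+ k) n)
  else f.

Fact fps_mulV : {in fps_unit, left_inverse 1 fps_inv *%R}.
Proof.
move=> f; rewrite unfold_in => uf; rewrite /fps_inv ifT //=.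
set a := f 0%N; set h := 1 - _ *: f; set S := Fps _.
have h0 : h 0%N = 0 by rewrite /h fpsDE fpsNE fpsZE mulVf ?subrr.
have -> : (a^-1 *: S) * f = S * (1 - h).
  rewrite /h subKr -fps_scaleAl ![S * _]mulrC fps_scaleAl //.
apply: fpsP => n.
have -> : (S * (1 - h)) n = ((\sum_(k < n.+1) h ^+ k) * (1 - h)) n.
  rewrite !fpsME; apply: eq_bigr => i _; congr (_ * _).
  rewrite /S /= !fps_sumE -!(big_mkord predT (fun k => (h ^+ k) (nat_of_ord i))).
  rewrite [in RHS](@big_cat_nat _ _ _ i.+1) //= [X in _ + X]big_nat_cond.
  rewrite [X in _ + X]big1 ?addr0 // => k /andP[/andP[ltik _] _].
  exact: fpsX_small.
have -> : (\sum_(k < n.+1) h ^+ k) * (1 - h) = 1 - h ^+ n.+1.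
  rewrite mulrC -opprB mulNr -subrX1; exact: opprB.
by rewrite fpsDE fpsNE fpsX_small // subr0.
Qed.
Fact fps_unitP f g : g * f = 1 -> fps_unit f.
Proof.
move=> /(congr1 (fun s : {fps R} => s 0%N)).
rewrite fpsME big_ord1 fps1E => gf1.
by apply/eqP => f0; move/eqP: gf1; rewrite f0 mulr0 eq_sym oner_eq0.
Qed.
Fact fps_inv_out : {in [predC fps_unit], fps_inv =1 id}.
Proof. by move=> f nuf; rewrite /fps_inv ifN. Qed.

HB.instance Definition _ := GRing.ComNzRing_hasMulInverse.Build {fps R}
  fps_mulV fps_unitP fps_inv_out.

End FpsRing.

(* The variable u of R[[u]]. *)
Definition fpsX (R : fieldType) : {fps R} := Fps (fun n => (n == 1%N)%:R).

Lemma fpsXnE (R : fieldType) k n : (fpsX R ^+ k) n = (n == k)%:R.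
Proof.
elim: k n => [|k IHk] n; first by rewrite expr0 fps1E.
rewrite exprS fpsME big_ord_recl /= mul0r add0r.
case: n => [|n]; first by rewrite big_ord0.
rewrite big_ord_recl /= mul1r IHk subn1 /= big1 ?addr0 ?eqSS // => i _.
by rewrite mul0r.
Qed.

(* Limits for the product topology on coefficients with discrete R: each
    coefficient is eventually constant. *)
Definition fps_cvg (R : fieldType) (S : nat -> {fps R}) (s : {fps R}) : Prop :=
  forall n, exists N, forall k, (N <= k)%N -> S k n = s n.

(* The limit; 0 when there is none. *)
Definition fps_lim (R : fieldType) (S : nat -> {fps R}) : {fps R} :=
  xget 0 [set s | fps_cvg S s].

(* \sum_(i >= m) F i and \prod_(i >= m) F i.  A divergent product is 0, so an
   identity 1 + \sum_(i >= 1) a_i u^i = infprod m F entails convergence. *)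
Definition infsum (R : fieldType) (m : nat) (F : nat -> {fps R}) : {fps R} :=
  fps_lim (fun k => \sum_(m <= i < k) F i).
Definition infprod (R : fieldType) (m : nat) (F : nat -> {fps R}) : {fps R} :=
  fps_lim (fun k => \prod_(m <= i < k) F i).

Lemma fps_cvg_lim (R : fieldType) (S : nat -> {fps R}) s :
  fps_cvg S s -> fps_lim S = s.
Proof.
move=> Ss; apply: xget_unique => // t St; apply: fpsP => n.
have [N1 E1] := Ss n; have [N2 E2] := St n.
by rewrite -(E1 (maxn N1 N2)) ?leq_maxl // E2 ?leq_maxr.
Qed.

Lemma infsum_cvg (R : fieldType) m (F : nat -> {fps R}) :
  (forall i n, (n < i)%N -> F i n = 0) ->
  fps_cvg (fun k => \sum_(m <= i < k) F i) (infsum m F).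
Proof.
move=> F0; pose s := Fps (fun n => \sum_(m <= i < maxn m n.+1) F i n).
have Ss : fps_cvg (fun k => \sum_(m <= i < k) F i) s.
  move=> n; exists (maxn m n.+1) => k lek; rewrite fps_sumE /=.
  rewrite (@big_cat_nat _ _ _ (maxn m n.+1)) ?leq_maxl //= big_nat_cond.
  rewrite [X in _ + X]big_nat_cond [X in _ + X]big1 -?big_nat_cond ?addr0 //.
  by move=> i /andP[/andP[]]; rewrite geq_max => /andP[_ /F0].
by rewrite /infsum (fps_cvg_lim Ss).
Qed.

Section Classes.
Variable F : finFieldType.

Definition in_Phi (f : {poly F}) : Prop :=
  [/\ irreducible_poly f, f \is monic & f != 'X].

Definition int_partition (l : seq nat) : bool := sorted geq l && (0 \notin l)%N.

(* Combinatorial data: the list of the pairs (f_i, lambda_{f_i}). *)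
Definition comb_data : Type := seq ({poly F} * seq nat).

Definition is_comb_data (n : nat) (D : comb_data) : Prop :=
  [/\ uniq (unzip1 D),
      forall fl, fl \in D -> in_Phi fl.1,
      forall fl, fl \in D -> int_partition fl.2 && (fl.2 != [::])
    & (\sum_(fl <- D) sumn fl.2 * (size fl.1).-1)%N = n].

Definition elem_divisors (D : comb_data) : seq {poly F} :=
  [seq fl.1 ^+ k | fl <- D, k <- fl.2].

(* The F[x]-module of column vectors on which x acts as A is isomorphic to
   the direct sum of the F[x]/(s_i).  The library's {poly %/ p} is F[x]/(p)
   when p is monic and non constant, which holds for the elementary divisors
   of valid data. *)
Definition module_iso (n : nat) (A : 'M[F]_n) (s : seq {poly F}) : Prop :=
  exists phi : forall i : 'I_(size s), {linear 'cV[F]_n -> {poly %/ s`_i}},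
    (forall i v, phi i (A *m v) = 'qX * phi i v) /\
    bijective (fun v => [ffun i => phi i v]
                 : {dffun forall i : 'I_(size s), {poly %/ s`_i}}).

Definition has_comb_data (n : nat) (A : 'M[F]_n) (D : comb_data) : Prop :=
  is_comb_data n D /\ module_iso A (elem_divisors D).

Definition regular (n : nat) (A : 'M[F]_n) : Prop :=
  exists2 D, has_comb_data A D & forall fl, fl \in D -> size fl.2 = 1%N.

Definition regular_semisimple (n : nat) (A : 'M[F]_n) : Prop :=
  exists2 D, has_comb_data A D & forall fl, fl \in D -> fl.2 = [:: 1%N].

(* {'GL_n[F]} is GL(n, F) for n >= 1 only: its elements are matrices of size
   n.-1.+1. *)
Definition GL_powers (n M : nat) : {set {'GL_n[F]}} :=
  [set (x ^+ M)%g | x in 'GL_n[F]%g].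

Definition GL_rg (n M : nat) : {set {'GL_n[F]}} :=
  [set g in GL_powers n M | `[< regular (GLval g) >]].

Definition GL_rs (n M : nat) : {set {'GL_n[F]}} :=
  [set g in GL_powers n M | `[< regular_semisimple (GLval g) >]].

Definition M_power_poly (M : nat) (f : {poly F}) : Prop :=
  [/\ f \is monic, irreducible_poly f
    & exists g : {poly F},
        [/\ irreducible_poly g, g %| f \Po 'X^M & size g = size f]].

(* N_M(q, d) for q = #|F|; {poly_d.+1 F} is the finite type of polynomials of
   degree at most d. *)
Definition N_power (M d : nat) : nat :=
  #|[set f : {poly_d.+1 F} | `[< [/\ size f = d.+1,
       in_Phi (f : {poly F}) & M_power_poly M (f : {poly F})] >]]|.

End Classes.

(* Main.v *)
Require Import Defs.
From HB Require Import structures.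
From mathcomp Require Import all_boot all_order all_algebra all_fingroup all_field.
From mathcomp Require Import boolp ring.

Set Implicit Arguments.
Unset Strict Implicit.
Unset Printing Implicit Defensive.

Import GRing.Theory Num.Theory.
Local Open Scope ring_scope.

(** A regular matrix [A] is one whose module is cyclic: its elementary divisors
    are powers of distinct irreducible polynomials, so that the module is
    [F[X]/(P)] with [P] the characteristic polynomial ([regular_inP]).  The
    invertible cyclic matrices with characteristic polynomial [P] form a single
    conjugacy class, and the centralizer of such a matrix [A] consists of the
    units of [F[A]], isomorphic to [F[X]/(P)].  They therefore make up the
    proportion [1 / unit_count P] of the linear group ([card_cyclic_class]).

    Whether [A] is an [M]-th power also depends only on [P].  A root of [A]
    commutes with [A], so it is a polynomial in [A], and it exists exactly when
    ['X] is an [M]-th power modulo [P] ([mem_GL_powers]).  By Chinese remainders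
    and because [M] is prime to the characteristic, it is enough to have a root
    modulo every irreducible factor [f] of [P] ([X_is_power_irr]), and this is
    the condition that [f] be an [M]-power polynomial ([M_power_polyP]).

    So the coefficient of [u ^+ n] in the generating functions is the sum of
    [1 / unit_count P] over the polynomials [P] of degree [n] whose irreducible
    factors are [M]-power polynomials other than ['X], with multiplicity one in
    the semisimple case.  As [unit_count] is multiplicative on coprime factors
    and known on powers of irreducible polynomials ([unit_countM],
    [unit_countX]), unique factorization turns this sum into an Euler product
    ([euler_product]).  Both cases are treated together, with a predicate [J] on
    multiplicities.  The last form of the regular case sums the geometric series
    in each factor ([local_factor_rgE]). *)

(** * Irreducible factors and multiplicities *)

Section PolyFactor.
Variable F : fieldType.
Implicit Types (d f g p r P : {poly F}).

Lemma irredp_ndvd_coprime f p : irreducible_poly f -> ~~ (f %| p) -> coprimep f p.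
Proof. by move=> irr_f; rewrite irreducible_poly_coprime // => ->. Qed.

Lemma irredp_dvdM f p r :
  irreducible_poly f -> (f %| p * r) = (f %| p) || (f %| r).
Proof.
move=> irr_f; have [fp | nfp] := boolP (f %| p); first exact: dvdp_mulr.
by rewrite Gauss_dvdpr //; apply: irredp_ndvd_coprime.
Qed.

Lemma irredp_ndvd1 f : irreducible_poly f -> ~~ (f %| 1).
Proof. by case=> sf _; rewrite dvdp1; case: eqP sf => // ->. Qed.

Lemma monic_irredp_dvd_eq f g : irreducible_poly f -> irreducible_poly g ->
  f \is monic -> g \is monic -> f %| g -> f = g.
Proof.
move=> [sf _] irr_g mf mg fg; apply/eqP; rewrite -eqp_monic //.
by apply: irr_g.2 => //; case: eqP sf => // ->.
Qed.

Lemma monic_irredp_coprime f g : irreducible_poly f -> irreducible_poly g ->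
  f \is monic -> g \is monic -> f != g -> coprimep f g.
Proof.
move=> irr_f irr_g mf mg fneg; apply: irredp_ndvd_coprime => //.
by apply: contraNN fneg => fg; apply/eqP/monic_irredp_dvd_eq.
Qed.

Lemma monic_irredp_divisor p : (size p > 1)%N ->
  exists f, [/\ f \is monic, irreducible_poly f & f %| p].
Proof.
move=> sp; pose Q k := `[< exists r : {poly F}, [/\ r %| p, (size r > 1)%N & size r = k] >].
have exQ : exists k, Q k by exists (size p); apply/asboolP; exists p; rewrite dvdpp.
have [k /asboolP[r [rp sr <-]] min_r] := ex_minnP exQ.
have r0 : r != 0 by rewrite -size_poly_gt0 ltnW.
have lr0 : lead_coef r != 0 by rewrite lead_coef_eq0.
have irr : irreducible_poly r.
  split=> // q sq qr; rewrite -dvdp_size_eqp // eqn_leq dvdp_leq //=.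
  apply: min_r; apply/asboolP; exists q; split=> //; first exact: dvdp_trans rp.
  rewrite ltn_neqAle eq_sym sq size_poly_gt0; apply: contraNneq r0 => q0.
  by rewrite q0 dvd0p in qr.
exists ((lead_coef r)^-1 *: r); split; last by rewrite dvdpZl ?invr_eq0.
  by rewrite monicE lead_coefZ mulVf.
split; first by rewrite size_scale ?invr_eq0.
move=> q sq; rewrite dvdpZr ?invr_eq0 // => qr.
by rewrite (eqp_trans (irr.2 q sq qr)) // eqp_sym eqp_scale // invr_eq0.
Qed.

Lemma coprimep_prodr (I : Type) (s : seq I) (Q : pred I) (E : I -> {poly F}) p :
  (forall i, Q i -> coprimep p (E i)) -> coprimep p (\prod_(i <- s | Q i) E i).
Proof.
move=> cop; elim/big_rec: _ => [|i r Qi cr]; first exact: coprimep1.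
by rewrite coprimepMr cop.
Qed.

Lemma dvdp_prod_coprime (I : eqType) (s : seq I) (Q : pred I) (E : I -> {poly F}) p :
  uniq s -> {in s &, forall i j, Q i -> Q j -> i != j -> coprimep (E i) (E j)} ->
  (\prod_(i <- s | Q i) E i %| p) = all (fun i => Q i ==> (E i %| p)) s.
Proof.
elim: s => [|i s IHs] /=; first by rewrite big_nil dvd1p.
case/andP=> nis us cop; rewrite big_cons; case: ifP => Qi /=; last first.
  by apply: IHs => // j k js ks; apply: cop; rewrite inE ?js ?ks orbT.
rewrite Gauss_dvdp; first congr (_ && _).
  by apply: IHs => // j k js ks; apply: cop; rewrite inE ?js ?ks orbT.
rewrite big_seq_cond; apply: coprimep_prodr => j /andP[js Qj].
apply: cop; rewrite ?inE ?eqxx ?js ?orbT //.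
by apply: contraNneq nis => ->.
Qed.

Lemma npoly_dvd_sub_inj d (b c : {poly_(size d).-1 F}) : d != 0 ->
  d %| (b : {poly F}) - (c : {poly F}) -> b = c.
Proof.
move=> d0 dbc; apply/val_inj/eqP; rewrite -subr_eq0 /=.
apply: contraTT dbc => nz; apply/negP=> /(dvdp_leq nz); apply/negP; rewrite -ltnNge.
apply: (@leq_ltn_trans (size d).-1); last by rewrite ltn_predL size_poly_gt0.
by rewrite (leq_trans (size_polyD _ _)) // size_polyN geq_max !size_npoly.
Qed.

(** The bound [size P] on the exponents loses nothing when [P] is nonzero and
    [f] is not constant, since the degree of [f ^+ j] is then at least [j]. *)
Definition mult f P : nat := \max_(j < size P | f ^+ j %| P) j.

Lemma ltn_size_exp f k : (size f > 1)%N -> (k < size (f ^+ k))%N.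
Proof.
move=> sf; have f0 : f != 0 by rewrite -size_poly_gt0 ltnW.
rewrite -[size (f ^+ k)]prednK ?size_poly_gt0 ?expf_neq0 // size_exp ltnS.
by rewrite leq_pmull // -ltnS prednK // ltnW.
Qed.

Lemma leq_mult f P k : (size f > 1)%N -> P != 0 ->
  (k <= mult f P)%N = (f ^+ k %| P).
Proof.
move=> sf P0; apply/idP/idP => [|fkP].
  have sP : (0 < size P)%N by rewrite size_poly_gt0.
  have [j fjP ->] : {j : 'I_(size P) | f ^+ j %| P & mult f P = j}.
    apply: eq_bigmax_cond; apply/card_gt0P; exists (Ordinal sP).
    exact: dvd1p.
  by move=> lekj; apply: dvdp_trans fjP; apply: dvdp_exp2l.
have ltk : (k < size P)%N by apply: leq_trans (dvdp_leq P0 fkP); apply: ltn_size_exp.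
exact: (leq_bigmax_cond (Ordinal ltk)).
Qed.

Lemma mult_uniq f P k : (size f > 1)%N -> P != 0 ->
  f ^+ k %| P -> ~~ (f ^+ k.+1 %| P) -> mult f P = k.
Proof.
move=> sf P0; rewrite -!leq_mult // -ltnNge ltnS => le1 le2.
by apply/eqP; rewrite eqn_leq le1 le2.
Qed.

Lemma mult_gt0 f P : (size f > 1)%N -> P != 0 -> (0 < mult f P)%N = (f %| P).
Proof. by move=> sf P0; rewrite leq_mult // expr1. Qed.

Lemma mult_prod (I : finType) (Q : pred I) (E : I -> {poly F}) (e : I -> nat) i :
  injective E -> (forall j, Q j -> irreducible_poly (E j) /\ E j \is monic) ->
  Q i -> mult (E i) (\prod_(j | Q j) E j ^+ e j) = e i.
Proof.
move=> injE irrE Qi; have [irr_i mi] := irrE i Qi.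
have n0 : \prod_(j | Q j) E j ^+ e j != 0.
  rewrite monic_neq0 //; apply: monic_prod => j /irrE[_ mj]; exact: monic_exp.
apply: mult_uniq => //; first exact: irr_i.1; first by rewrite (bigD1 i) //= dvdp_mulr.
rewrite (bigD1 i) //= exprSr dvdp_mul2l ?expf_neq0 ?(irredp_neq0 irr_i) //.
apply/negP => dv; have si := irr_i.1.
have : coprimep (E i) (E i); last by rewrite coprimepp; case: eqP si => // ->.
apply: coprimep_dvdl dv _; apply: coprimep_prodr => j /andP[Qj neji].
apply: coprimep_expr; have [? ?] := irrE j Qj.
by apply: monic_irredp_coprime => //; rewrite (inj_eq injE) eq_sym.
Qed.

Lemma mult_prod0 (I : finType) (Q : pred I) (E : I -> {poly F}) (e : I -> nat) f :
  (forall j, Q j -> irreducible_poly (E j) /\ E j \is monic) ->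
  irreducible_poly f -> f \is monic -> (forall j, Q j -> E j != f) ->
  mult f (\prod_(j | Q j) E j ^+ e j) = 0%N.
Proof.
move=> irrE irr_f mf neE.
have n0 : \prod_(j | Q j) E j ^+ e j != 0.
  rewrite monic_neq0 //; apply: monic_prod => j /irrE[_ mj]; exact: monic_exp.
apply: mult_uniq => //; rewrite ?expr0 ?dvd1p ?expr1 //; first exact: irr_f.1.
apply/negP => dv; have si := irr_f.1.
have : coprimep f f; last by rewrite coprimepp; case: eqP si => // ->.
apply: coprimep_dvdl dv _; apply: coprimep_prodr => j Qj.
apply: coprimep_expr; have [? ?] := irrE j Qj.
by apply: monic_irredp_coprime => //; rewrite eq_sym neE.
Qed.

(** Unique factorization, over a finite family that contains every monic
    irreducible divisor of [P]: if the quotient of [P] by the product were not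
    constant, an irreducible divisor of it would have a larger multiplicity. *)
Lemma prod_mult (I : finType) (Q : pred I) (E : I -> {poly F}) P :
  injective E -> (forall j, Q j -> irreducible_poly (E j) /\ E j \is monic) ->
  P \is monic ->
  (forall f, irreducible_poly f -> f \is monic -> f %| P -> exists2 j, Q j & E j = f) ->
  P = \prod_(j | Q j) E j ^+ mult (E j) P.
Proof.
move=> injE irrE mP allE; set R := \prod_(j | _) _.
have mR : R \is monic by apply: monic_prod => j /irrE[_ mj]; exact: monic_exp.
have RP : R %| P.
  rewrite dvdp_prod_coprime ?index_enum_uniq //.
    apply/allP=> j _; apply/implyP=> Qj; rewrite -leq_mult ?monic_neq0 //.
    by have [[]] := irrE j Qj.
  move=> i j _ _ Qi Qj neij; apply: coprimep_expl; apply: coprimep_expr.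
  have [? ?] := irrE i Qi; have [? ?] := irrE j Qj.
  by apply: monic_irredp_coprime => //; rewrite (inj_eq injE).
have [r1 | r_gt1] := leqP (size (P %/ R)) 1%N.
  have Pr : P = P %/ R * R by rewrite divpK.
  have r0 : P %/ R != 0.
    by apply: contraTneq (monic_neq0 mP) => r0; rewrite Pr r0 mul0r eqxx.
  have sr : size (P %/ R) = 1%N by apply/eqP; rewrite eqn_leq r1 size_poly_gt0.
  apply/eqP; rewrite eq_sym -eqp_monic // -dvdp_size_eqp //.
  by rewrite -(divpK RP) size_mul ?(monic_neq0 mR) // sr.
have [f [mf irr_f fr]] := monic_irredp_divisor r_gt1.
have fP : f %| P by rewrite -(divpK RP) dvdp_mulr.
have [j Qj Ej] := allE f irr_f mf fP.
have : f ^+ (mult f P).+1 %| P.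
  have fR : f ^+ mult f P %| R by rewrite /R (bigD1 j) //= Ej dvdp_mulr.
  by have := dvdp_mul fr fR; rewrite divpK // -exprS.
by rewrite -leq_mult ?ltnn ?monic_neq0 //; exact: irr_f.1.
Qed.

End PolyFactor.

(** * Roots of the variable modulo a polynomial *)

Section PowerRoots.
Variables (F : finFieldType) (M : nat).
Implicit Types (f g p r P b : {poly F}).

(** ['X] is an [M]-th power in [F[X]/(P)].  Working with divisibility rather
    than in the quotient ring makes it easy to let [P] vary. *)
Definition X_is_power P := exists b, P %| b ^+ M - 'X.

Lemma X_is_power_dvd P r : r %| P -> X_is_power P -> X_is_power r.
Proof. by move=> rP [b Pb]; exists b; apply: dvdp_trans Pb. Qed.

(** Chinese remainders: the root exhibited is [b] modulo [P] and [c] modulo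
    [r]. *)
Lemma X_is_power_coprime P r : coprimep P r ->
  X_is_power P -> X_is_power r -> X_is_power (P * r).
Proof.
move=> cop [b Pb] [c rc]; have [[u v] /= Duv] := Bezout_eq1_coprimepP _ _ cop.
exists (b * (v * r) + c * (u * P)).
have sub_exp (x y d : {poly F}) : d %| x - y -> d %| x ^+ M - y ^+ M.
  by rewrite subrXX => ?; rewrite dvdp_mulr.
rewrite Gauss_dvdp //; apply/andP; split.
  rewrite -(subrKA (b ^+ M)) dvdp_add // sub_exp //.
  have -> : b * (v * r) + c * (u * P) - b = (c - b) * (u * P).
    by rewrite -{2}[b]mulr1 -Duv; ring.
  by rewrite !dvdp_mull.
rewrite -(subrKA (c ^+ M)) dvdp_add // sub_exp //.
have -> : b * (v * r) + c * (u * P) - c = (b - c) * (v * r).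
  by rewrite -{2}[c]mulr1 -Duv; ring.
by rewrite !dvdp_mull.
Qed.

Lemma pchar_nat_card s : [pchar {poly F}].-nat (#|F| ^ s)%N.
Proof.
have [p pr_p cFp] := finPcharP F; rewrite pnatX; apply/orP; left.
have pF : p \in [pchar {poly F}] by rewrite pchar_poly.
apply: pi_pnat pF; have := abelian.fin_ring_pchar_abelem cFp.
by move/abelian.abelem_pgroup; rewrite /pgroup.pgroup cardsT.
Qed.

(** Lifting a root modulo [f] to a root modulo [f ^+ k] without successive
    approximation: with [e] a large power of the characteristic, the root [b]
    gives [f ^+ e %| b ^+ (M * e) - 'X^e], and since [e] is invertible modulo
    [M] there are [m] and [n] with [e * m = M * n + 1], so that ['X] is the
    [M]-th power of [b ^+ (e * m)] divided by ['X^n]. *)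
Lemma X_is_power_exp f k : coprime #|F| M -> (0 < M)%N -> coprimep f 'X ->
  X_is_power f -> X_is_power (f ^+ k).
Proof.
move=> copM M0 copX [b fb]; pose e := (#|F| ^ k)%N.
have lek : (k <= e)%N by apply/ltnW/ltn_expl/card_finNzRing_gt1.
have e_gt0 : (0 < e)%N by rewrite expn_gt0 (ltnW (card_finNzRing_gt1 F)).
have cop_e : coprime e M by rewrite coprimeXl.
have fe : f ^+ e %| b ^+ (M * e) - 'X^e.
  have -> : b ^+ (M * e) - 'X^e = (b ^+ M - 'X) ^+ e.
    by rewrite exprDn_pchar ?pchar_nat_card // exprNn_pchar ?pchar_nat_card // exprM.
  exact: dvdp_exp2r.
case: (egcdnP M e_gt0) => m n Dmn _; rewrite (eqP cop_e) in Dmn.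
have copXe : coprimep ('X^n) (f ^+ k).
  by rewrite coprimep_expl // coprimep_expr // coprimep_sym.
have [[h v] /= Dhv] := Bezout_eq1_coprimepP _ _ copXe.
exists (b ^+ (e * m) * h).
have fXh : f ^+ k %| ('X^n * h) ^+ M - 1.
  rewrite -[X in _ - X](expr1n _ M) subrXX dvdp_mulr //.
  by rewrite -Dhv [h * _]mulrC opprD addNKr dvdpNr dvdp_mull.
have fbm : f ^+ k %| b ^+ (M * e * m) - 'X * 'X^n ^+ M.
  apply: dvdp_trans (dvdp_exp2l f lek) (dvdp_trans fe _).
  have -> : 'X * 'X^n ^+ M = ('X^e) ^+ m :> {poly F}.
    by rewrite -!exprM -exprS [(e * m)%N]mulnC Dmn addn1.
  by rewrite [b ^+ (_ * m)]exprM subrXX dvdp_mulr.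
have -> : (b ^+ (e * m) * h) ^+ M - 'X =
   (b ^+ (M * e * m) - 'X * 'X^n ^+ M) * h ^+ M + 'X * (('X^n * h) ^+ M - 1).
  rewrite !exprMn -[b ^+ _ ^+ M]exprM [(e * m * M)%N]mulnC mulnA.
  by move: (b ^+ _) ('X^n ^+ M) (h ^+ M) => x y z; ring.
by apply: dvdp_add; [apply: dvdp_mulr | apply: dvdp_mull].
Qed.

Lemma X_is_power_prod (I : eqType) (s : seq I) (Q : pred I) (E : I -> {poly F}) :
  uniq s -> {in s &, forall i j, Q i -> Q j -> i != j -> coprimep (E i) (E j)} ->
  (forall i, i \in s -> Q i -> X_is_power (E i)) ->
  X_is_power (\prod_(i <- s | Q i) E i).
Proof.
elim: s => [|i s IHs] /= => [_ _ _|].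
  by rewrite big_nil; exists 0; rewrite dvd1p.
case/andP=> nis us cop powE; rewrite big_cons.
have IH : X_is_power (\prod_(j <- s | Q j) E j).
  apply: IHs => // [j k js ks|j js]; last by apply: powE; rewrite inE js orbT.
  by apply: cop; rewrite inE ?js ?ks orbT.
case: ifP => // Qi; apply: X_is_power_coprime => //; last first.
  by apply: powE => //; rewrite mem_head.
rewrite big_seq_cond; apply: coprimep_prodr => j /andP[js Qj].
apply: cop; rewrite ?inE ?eqxx ?js ?orbT //.
by apply: contraNneq nis => ->.
Qed.

(** Substituting [b] induces an injection from [F[X]/(f)] to [F[X]/(g)]; these
    rings being finite, sizes can be compared, and equal sizes give
    surjectivity. *)
Section CompMod.
Variables (b f g : {poly F}).
Hypothesis g0 : g != 0.
Hypothesis inj_fg : forall p, g %| p \Po b -> f %| p.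

Let h (p : {poly_(size f).-1 F}) := npolyp (size g).-1 (((p : {poly F}) \Po b) %% g).

Let small p : (size (p %% g)%R <= (size g).-1)%N.
Proof. by rewrite -ltnS prednK ?size_poly_gt0 // ltn_modp. Qed.

Let hE (p : {poly_(size f).-1 F}) : h p = ((p : {poly F}) \Po b) %% g :> {poly F}.
Proof. by rewrite /h npolypK // small. Qed.

Let inj_h : f != 0 -> injective h.
Proof.
move=> f0 p1 p2 /(congr1 (@polyn _ _)); rewrite !hE => eq12.
have /inj_fg f12 : g %| ((p1 : {poly F}) - (p2 : {poly F})) \Po b.
  by rewrite /dvdp comp_polyB modpD modpN eq12 subrr.
exact: npoly_dvd_sub_inj f12.
Qed.

Lemma comp_poly_mod_inj_leq : (size f <= size g)%N.
Proof.
have [->|f0] := eqVneq f 0; first by rewrite size_poly0.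
have := leq_card h (inj_h f0); rewrite !card_npoly leq_exp2l ?card_finNzRing_gt1 //.
by rewrite -ltnS !prednK // size_poly_gt0.
Qed.

Lemma comp_poly_mod_surj r : f != 0 -> size f = size g ->
  exists p, g %| (p \Po b) - r.
Proof.
move=> f0 sfg; have := inj_card_onto (inj_h f0) _ (npolyp _ (r %% g)).
have le_card : (#|{poly_(size g).-1 F}| <= #|{poly_(size f).-1 F}|)%N.
  by rewrite !card_npoly sfg.
move=> /(_ le_card) /codomP[p] /(congr1 (@polyn _ _)).
rewrite hE npolypK ?small //.
by move=> Dr; exists p; rewrite /dvdp modpD modpN Dr subrr.
Qed.

End CompMod.

(** A nonzero ring morphism out of the field [F[X]/(f)] is injective. *)
Lemma comp_poly_mod_irr b f g p : irreducible_poly f -> ~~ (g %| 1) ->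
  g %| f \Po b -> g %| p \Po b -> f %| p.
Proof.
move=> irr_f ng1 gfb gpb; apply: contraNT ng1 => nfp.
have [[u v] /= Duv] := Bezout_eq1_coprimepP _ _ (irredp_ndvd_coprime irr_f nfp).
have := congr1 (comp_poly b) Duv.
by rewrite comp_polyD !comp_polyM comp_polyC polyC1 => <-; rewrite dvdp_add // dvdp_mull.
Qed.

Lemma dvdp_sub_comp p b c : b - c %| (p \Po b) - (p \Po c).
Proof.
elim/poly_ind: p => [|p k IHp]; first by rewrite !comp_poly0 subrr dvdp0.
rewrite !comp_polyD !comp_polyM !comp_polyX !comp_polyC.
set x := p \Po b in IHp *; set y := p \Po c in IHp *.
have -> : x * b + k%:P - (y * c + k%:P) = (x - y) * b + y * (b - c) by ring.
by apply: dvdp_add; [apply: dvdp_mulr | apply: dvdp_mull].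
Qed.

(** With [a] the class of ['X] in the field [F[X]/(f)], a factor [g] of
    [f \Po 'X^M] of the degree of [f] is the minimal polynomial of an [M]-th
    root of [a].  If [b] represents that root, then [p |-> p \Po 'X^M] and
    [p |-> p \Po b] are inverse isomorphisms between [F[X]/(f)] and
    [F[X]/(g)]. *)
Lemma M_power_polyP f : (0 < M)%N -> f \is monic -> irreducible_poly f ->
  (M_power_poly M f <-> X_is_power f).
Proof.
move=> M0 mf irr_f; have f0 := irredp_neq0 irr_f; have nf1 := irredp_ndvd1 irr_f.
split=> [[_ _ [g [irr_g gf sgf]]] | [b fb]].
  have kerf p := comp_poly_mod_irr (p := p) irr_f (irredp_ndvd1 irr_g) gf.
  have [b Db] := comp_poly_mod_surj (irredp_neq0 irr_g) kerf 'X f0 (esym sgf).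
  exists b; apply: kerf; rewrite comp_polyB comp_polyX rmorphXn /= subrXX.
  exact: dvdp_mulr.
have fcomp p : f %| (p \Po 'X^M) \Po b -> f %| p.
  rewrite -comp_polyA comp_Xn_poly => fpb.
  have := dvdp_trans fb (dvdp_sub_comp p (b ^+ M) 'X).
  by rewrite comp_polyXr dvdp_subr.
have fcomp' p : f %| p -> f %| (p \Po 'X^M) \Po b.
  rewrite -comp_polyA comp_Xn_poly => fp.
  have := dvdp_trans fb (dvdp_sub_comp p (b ^+ M) 'X).
  by rewrite comp_polyXr dvdp_subl.
have nz r : f %| r \Po b -> r != 0 -> (1 < size r)%N.
  move=> frb r0; rewrite ltnNge; apply: contra nf1 => /size1_polyC Dr.
  move: frb r0; rewrite Dr comp_polyC polyC_eq0 => fr r0.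
  by have := dvdp_mulr (r`_0)^-1%:P fr; rewrite -polyCM mulfV.
(* By minimality, g generates the kernel of p |-> p \Po b modulo f. *)
have [g [sg gb min_g]] : exists g, [/\ (size g > 1)%N, f %| g \Po b &
   forall r, (size r > 1)%N -> f %| r \Po b -> (size g <= size r)%N].
  pose Q k := `[< exists r : {poly F}, [/\ (size r > 1)%N, f %| r \Po b & size r = k] >].
  have exQ : exists k, Q k.
    exists (size (f \Po 'X^M)); apply/asboolP; exists (f \Po 'X^M); split=> //.
      by apply: nz (fcomp' f (dvdpp f)) _; rewrite comp_poly_eq0 ?size_polyXn ?ltnS.
    exact: fcomp' (dvdpp f).
  have [k /asboolP[g [sg gb <-]] min_g] := ex_minnP exQ.
  by exists g; split=> // r sr rb; apply: min_g; apply/asboolP; exists r.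
have g0 : g != 0 by rewrite -size_poly_gt0 ltnW.
have irr_g : irreducible_poly g.
  split=> // r sr rg; rewrite -dvdp_size_eqp // eqn_leq dvdp_leq //=.
  have := rg; rewrite dvdp_eq => /eqP Dg; have := gb.
  have q0 : g %/ r != 0 by apply: contraTneq g0 => q0; rewrite Dg q0 mul0r eqxx.
  have r0 : r != 0 by apply: contraTneq g0 => r0; rewrite Dg r0 mulr0 eqxx.
  rewrite {1}Dg comp_polyM irredp_dvdM // => /orP[fq | fr]; last exact: min_g (nz _ fr r0) fr.
  have := min_g _ (nz _ fq q0) fq.
  have -> : size g = (size (g %/ r)%R + size r).-1 by rewrite {1}Dg size_mul.
  have r_gt1 : (1 < size r)%N by rewrite ltn_neqAle eq_sym sr size_poly_gt0.
  by move: (size r) r_gt1 => [|[|k]] // _; rewrite !addnS /= ltnNge leq_addr.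
have gf : g %| f \Po 'X^M.
  rewrite /dvdp; apply: contraT => nz_mod.
  have fmod : f %| ((f \Po 'X^M) %% g) \Po b.
    have := fcomp' f (dvdpp _); rewrite {1}(divp_eq (f \Po 'X^M) g) comp_polyD comp_polyM.
    by rewrite dvdp_addr // dvdp_mull.
  by have := min_g _ (nz _ fmod nz_mod) fmod; rewrite leqNgt ltn_modp g0.
split=> //; exists g; split=> //; apply/eqP; rewrite eqn_leq; apply/andP; split.
  by apply: (@comp_poly_mod_inj_leq b) => // p; apply: comp_poly_mod_irr.
apply: (@comp_poly_mod_inj_leq 'X^M) => // p gp; apply: fcomp.
by apply: dvdp_trans gb _; apply: dvdp_comp_poly.
Qed.

(** A predicate on a finite type, so that products over the monic irreducible
    polynomials of bounded degree are big operators. *)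
Definition irr_monic K (f : {poly_K F}) :=
  ((f : {poly F}) \is monic) && irreducibleb (f : {poly F}).

Lemma irr_monicP K (f : {poly_K F}) :
  reflect (irreducible_poly (f : {poly F}) /\ (f : {poly F}) \is monic) (irr_monic f).
Proof.
apply: (iffP andP) => [[mf /irreducibleP irr_f] | [irr_f mf]] //; split=> //.
exact/irreducibleP.
Qed.

Lemma irr_monic_npoly K f : irreducible_poly f -> f \is monic -> (size f <= K)%N ->
  exists2 g : {poly_K F}, irr_monic g & g = f :> {poly F}.
Proof.
move=> irr_f mf sf; exists (npolyp K f); last exact: npolypK.
by apply/irr_monicP; rewrite npolypK.
Qed.

Lemma prod_mult_npoly K P : P \is monic -> (size P <= K)%N ->
  P = \prod_(f : {poly_K F} | irr_monic f) (f : {poly F}) ^+ mult f P.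
Proof.
move=> mP sP; apply: prod_mult => //; first exact: val_inj.
  by move=> f /irr_monicP.
move=> f irr_f mf fP; apply: irr_monic_npoly => //.
by apply: leq_trans sP; rewrite dvdp_leq ?monic_neq0.
Qed.

(** The condition only depends on the irreducible factors of [P]: powers are
    handled by lifting roots, and coprime factors by Chinese remainders. *)
Lemma X_is_power_irr P : coprime #|F| M -> (0 < M)%N -> P \is monic -> coprimep P 'X ->
  X_is_power P <->
  (forall f, irreducible_poly f -> f \is monic -> f %| P -> M_power_poly M f).
Proof.
move=> copM M0 mP copX; split=> [powP f irr_f mf fP | powP].
  by apply/M_power_polyP => //; apply: X_is_power_dvd powP.
rewrite (prod_mult_npoly mP (leqnn _)); apply: X_is_power_prod.
- exact: index_enum_uniq.
- move=> f g _ _ /irr_monicP[irr_f mf] /irr_monicP[irr_g mg] neq_fg.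
  by apply/coprimep_expl/coprimep_expr/monic_irredp_coprime.
move=> f _ /irr_monicP[irr_f mf].
have [-> | ] := posnP (mult f P); first by exists 0; rewrite expr0 dvd1p.
rewrite mult_gt0 ?monic_neq0 //; last exact: irr_f.1.
move=> fP; apply: X_is_power_exp => //; first exact: coprimep_dvdr fP copX.
by apply/M_power_polyP => //; apply: powP.
Qed.

(** * Units modulo a polynomial *)

(** The number of units of [F[X]/(P)]. *)
Definition unit_count P := #|[set b : {poly_(size P).-1 F} | coprimep P b]|.

Lemma unit_count_gt0 P : P != 0 -> (0 < unit_count P)%N.
Proof.
move=> P0; apply/card_gt0P; exists (npolyp _ (1 %% P)); rewrite inE npolypK.
  by rewrite coprimep_modr coprimep1.
by rewrite -ltnS prednK ?size_poly_gt0 // ltn_modp.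
Qed.

Lemma unit_count1 : unit_count 1 = 1%N.
Proof.
rewrite /unit_count size_poly1 -[RHS](expn0 #|F|) -card_npoly.
by apply: eq_card => b; rewrite !inE coprime1p.
Qed.

(** Chinese remainders again, as a bijection with pairs of remainders. *)
Lemma unit_countM P r : P != 0 -> r != 0 -> coprimep P r ->
  unit_count (P * r) = (unit_count P * unit_count r)%N.
Proof.
move=> P0 r0 copPr.
have sP : (0 < size P)%N by rewrite size_poly_gt0.
have sr : (0 < size r)%N by rewrite size_poly_gt0.
have sPr : (size (P * r)).-1 = ((size P).-1 + (size r).-1)%N.
  by rewrite size_mul // -{1}(prednK sP) -{1}(prednK sr) addnS addSn.
pose h (b : {poly_(size (P * r)).-1 F}) :=
  (npolyp (size P).-1 (b %% P), npolyp (size r).-1 (b %% r)).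
have small d p : d != 0 -> (size (p %% d)%R <= (size d).-1)%N.
  by move=> d0; rewrite -ltnS prednK ?size_poly_gt0 // ltn_modp.
have inj_h : injective h.
  move=> b c [/(congr1 (@polyn _ _)) + /(congr1 (@polyn _ _))].
  rewrite !npolypK ?small // => eqP_ eqr.
  apply: npoly_dvd_sub_inj; first exact: mulf_neq0.
  by rewrite Gauss_dvdp // /dvdp !modpD !modpN eqP_ eqr !subrr eqxx.
have bij_h : bijective h.
  by apply: inj_card_bij => //; rewrite card_prod !card_npoly -expnD sPr.
rewrite /unit_count -cardsX -(on_card_preimset (onW_bij _ bij_h)).
apply: eq_card => b; rewrite !inE /= !npolypK ?small // !coprimep_modr.
by rewrite coprimepMl.
Qed.

Lemma unit_count_prod (I : eqType) (s : seq I) (Q : pred I) (E : I -> {poly F}) :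
  uniq s -> {in s &, forall i j, Q i -> Q j -> i != j -> coprimep (E i) (E j)} ->
  (forall i, Q i -> E i != 0) ->
  unit_count (\prod_(i <- s | Q i) E i) = (\prod_(i <- s | Q i) unit_count (E i))%N.
Proof.
move=> us cop nz; elim: s us cop => [|i s IHs] /= => [_ _|].
  by rewrite !big_nil unit_count1.
case/andP=> nis us cop; rewrite !big_cons.
have IH := IHs us _; case: ifP => Qi; last first.
  by apply: IH => j k js ks; apply: cop; rewrite inE ?js ?ks orbT.
rewrite unit_countM ?nz ?IH //.
- by move=> j k js ks; apply: cop; rewrite inE ?js ?ks orbT.
- by elim/big_rec: _ => [|j p Qj p0]; rewrite ?oner_eq0 // mulf_neq0 ?nz.
rewrite big_seq_cond; apply: coprimep_prodr => j /andP[js Qj].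
apply: cop; rewrite ?inE ?eqxx ?js ?orbT //.
by apply: contraNneq nis => ->.
Qed.

(** The nonunits modulo a power of [f] are the multiples of [f]. *)
Lemma unit_countX f j (d := (size f).-1) : irreducible_poly f ->
  unit_count (f ^+ j.+1) = (#|F| ^ (j * d) * (#|F| ^ d - 1))%N.
Proof.
move=> irr_f; have f0 := irredp_neq0 irr_f.
have sE k : (size (f ^+ k)).-1 = (k * d)%N by rewrite size_exp mulnC.
pose h (p : {poly_(j * d) F}) := npolyp (size (f ^+ j.+1)).-1 (f * p).
have hE (p : {poly_(j * d) F}) : h p = f * (p : {poly F}) :> {poly F}.
  rewrite npolypK // sE mulSn; have [->|p0] := eqVneq (p : {poly F}) 0.
    by rewrite mulr0 size_poly0.
  rewrite size_mul // -(prednK (_ : 0 < size f)%N) ?size_poly_gt0 //.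
  by rewrite addSn /= leq_add2l size_npoly.
have inj_h : injective h.
  move=> p1 p2 /(congr1 (@polyn _ _)); rewrite !hE => /(mulfI f0) ?.
  exact: val_inj.
have -> : unit_count (f ^+ j.+1) = #|~: [set h p | p : {poly_(j * d) F}]|.
  apply: eq_card => b; rewrite !inE coprimep_pexpl //.
  have -> : coprimep f b = ~~ (f %| b).
    apply/idP/idP => [cfb|]; last exact: irredp_ndvd_coprime.
    apply: contraL cfb => fb; have := irr_f.1; apply: contraL => cfb.
    by have := coprimep_dvdl fb cfb; rewrite coprimepp => /eqP ->.
  congr (~~ _); apply/idP/imsetP => [fb | [p _ ->]]; last by rewrite hE dvdp_mulr.
  exists (npolyp _ (b %/ f)) => //; apply: val_inj => /=; rewrite hE npolypK.
    by rewrite mulrC divpK.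
  rewrite size_divp // leq_subLR; apply: leq_trans (size_npoly b) _.
  by rewrite sE mulSn.
rewrite cardsCs setCK card_imset // !card_npoly sE mulSn expnD.
by rewrite mulnBr muln1 mulnC.
Qed.

End PowerRoots.

(** * Cyclic matrices *)

Section CyclicMatrices.
Variables (F : finFieldType) (n' : nat).
Local Notation n := n'.+1.
Implicit Types (A B : 'M[F]_n) (v w : 'cV[F]_n) (p P : {poly F}).

Definition coef_col p : 'cV[F]_n := \col_i p`_i.

(** The columns of this matrix are the iterates of [v] under [A]; [v] is a
    cyclic vector when they form a basis. *)
Definition krylov A v : 'M[F]_n := \matrix_(i, j) (A ^+ j *m v) i 0.

Definition cyclic_mx A := [exists v, krylov A v \in unitmx].

Lemma poly_sum_coef p : (size p <= n)%N -> p = \sum_(i < n) p`_i *: 'X^i.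
Proof.
move=> sp; rewrite -(poly_def n (fun i => p`_i)); apply/polyP => i.
by rewrite coef_poly; case: ltnP => // le; rewrite nth_default // (leq_trans sp).
Qed.

Lemma coef_col_inj p : (size p <= n)%N -> coef_col p = 0 -> p = 0.
Proof.
move=> sp /colP p0; apply/polyP=> i; rewrite coef0.
have [lti | lei] := ltnP i n; last by rewrite nth_default // (leq_trans sp).
by have := p0 (Ordinal lti); rewrite !mxE.
Qed.

Lemma coef_col_rVpoly (c : 'rV[F]_n) : coef_col (rVpoly c) = c^T.
Proof. by apply/colP=> i; rewrite !mxE coef_rVpoly_ord. Qed.

(** The Krylov matrix is the evaluation [p |-> p(A) v] in the basis of the
    monomials. *)
Lemma krylov_coef A v p : (size p <= n)%N ->
  krylov A v *m coef_col p = horner_mx A p *m v.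
Proof.
move=> sp; rewrite {2}(poly_sum_coef sp).
rewrite linear_sum mulmx_suml; apply/colP=> i; rewrite mxE summxE.
apply: eq_bigr => j _; rewrite linearZ /= rmorphXn /= horner_mx_X.
by rewrite -scalemxAl !mxE mulrC.
Qed.

Lemma size_mod_char_poly A p : (size (p %% char_poly A)%R <= n)%N.
Proof.
by rewrite -ltnS -(size_char_poly A) ltn_modp monic_neq0 // char_poly_monic.
Qed.

Lemma horner_mx_mod_char_poly A p : horner_mx A (p %% char_poly A) = horner_mx A p.
Proof.
rewrite [in RHS](divp_eq p (char_poly A)) rmorphD rmorphM /= Cayley_Hamilton.
by rewrite mulr0 add0r.
Qed.

Lemma dvdp_char_poly_horner A p : char_poly A %| p -> horner_mx A p = 0.
Proof. by case/dvdpP=> r ->; rewrite rmorphM /= Cayley_Hamilton mulr0. Qed.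

(** The remainder of [p] also annihilates [v], and its coefficients form a
    vector killed by the invertible Krylov matrix. *)
Lemma horner_cyclic_eq0 A v p : krylov A v \in unitmx ->
  horner_mx A p *m v = 0 -> char_poly A %| p.
Proof.
move=> uK; rewrite -horner_mx_mod_char_poly -krylov_coef ?size_mod_char_poly // => K0.
apply/eqP/coef_col_inj; first exact: size_mod_char_poly.
by rewrite -[LHS](mulKmx uK) K0 mulmx0.
Qed.

Lemma krylov_unit A v :
  (forall p, (size p <= n)%N -> horner_mx A p *m v = 0 -> p = 0) ->
  krylov A v \in unitmx.
Proof.
move=> ann0; rewrite -unitmx_tr -row_free_unit; apply: inj_row_free => c c0.
have sc : (size (rVpoly c) <= n)%N by rewrite size_poly.
have : rVpoly c = 0.
  apply: ann0 => //; rewrite -krylov_coef // coef_col_rVpoly -[krylov A v]trmxK -trmx_mul c0.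
  by rewrite trmx0.
by move/(congr1 (@poly_rV F n)); rewrite rVpolyK linear0.
Qed.

Lemma cyclic_span A v w : krylov A v \in unitmx ->
  exists2 p : {poly F}, (size p <= n)%N & w = horner_mx A p *m v.
Proof.
move=> uK; pose c := (invmx (krylov A v) *m w)^T.
exists (rVpoly c); first exact: size_poly.
rewrite -krylov_coef ?size_poly //.
by rewrite coef_col_rVpoly trmxK mulKVmx.
Qed.

(** If [B v = b(A) v], then [B] and [b(A)] agree on every [p(A) v] because both
    commute with [A], and these vectors are all the vectors. *)
Lemma comm_cyclic A B v : krylov A v \in unitmx -> A *m B = B *m A ->
  exists2 b : {poly F}, (size b <= n)%N & B = horner_mx A b.
Proof.
move=> uK AB; have [b sb Db] := cyclic_span (B *m v) uK.
exists b => //; have com p : B *m horner_mx A p = horner_mx A p *m B.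
  exact: comm_mx_horner.
have cols w : B *m w = horner_mx A b *m w.
  have [p _ ->] := cyclic_span w uK.
  rewrite !mulmxA com -(mulmxA _ B) Db !mulmxA; congr (_ *m _).
  exact: comm_horner_mx2.
by apply/matrixP=> i j; have := cols (delta_mx j 0); rewrite -!colE => /colP/(_ i); rewrite !mxE.
Qed.

(** The companion matrix of [P]: multiplication by ['X] on [F[X]/(P)] in the
    basis of the monomials. *)
Definition comp_mx P : 'M[F]_n := \matrix_(i, j) ('X^(j.+1) %% P)`_i.

(** In coordinates, [A * A^j v = A^(j+1) v]; the last column reduces to the
    previous ones by the Cayley-Hamilton theorem. *)
Lemma krylov_comp A v : A *m krylov A v = krylov A v *m comp_mx (char_poly A).
Proof.
apply/matrixP=> i j; set C := comp_mx _.
have -> : (krylov A v *m C) i j = (krylov A v *m coef_col ('X^(j.+1) %% char_poly A)) i 0.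
  by rewrite !mxE; apply: eq_bigr => k _; rewrite !mxE.
rewrite krylov_coef ?size_mod_char_poly // horner_mx_mod_char_poly.
rewrite rmorphXn /= horner_mx_X exprS -[A * _]/(A *m _) -mulmxA.
by rewrite !mxE; apply: eq_bigr => k _; rewrite !mxE.
Qed.

Lemma comp_mx_coef P p : (size p <= n)%N ->
  comp_mx P *m coef_col p = coef_col (('X * p) %% P).
Proof.
move=> sp.
have -> : ('X * p) %% P = \sum_(i < n) p`_i *: ('X^(i.+1) %% P).
  rewrite {1}(poly_sum_coef sp) mulr_sumr (big_morph (fun q => q %% P) (id1 := 0) (op1 := +%R)) ?mod0p //.
    by apply: eq_bigr => i _; rewrite -scalerAr modpZl exprS.
  by move=> x y; rewrite modpD.
apply/colP=> i; rewrite !mxE coef_sum; apply: eq_bigr => j _.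
by rewrite !mxE coefZ mulrC.
Qed.

(** The first basis vector stands for the class of 1. *)
Lemma horner_comp_mx P p : size P = n.+1 ->
  horner_mx (comp_mx P) p *m coef_col 1 = coef_col (p %% P).
Proof.
move=> sP; have P0 : P != 0 by rewrite -size_poly_eq0 sP.
elim/poly_ind: p => [|p c IHp].
  by rewrite linear0 mul0mx mod0p; apply/colP=> i; rewrite !mxE coef0.
rewrite mulrC rmorphD rmorphM /= horner_mx_X horner_mx_C mulmxDl -mulmxE -mulmxA IHp mul_scalar_mx.
rewrite comp_mx_coef; last by rewrite -ltnS -sP ltn_modp.
rewrite modp_mul modpD; apply/colP=> i; rewrite !mxE coefD; congr (_ + _).
rewrite modp_small ?sP ?size_polyC; last by case: (c == 0).
by rewrite coef1 coefC mulr_natr mulrb.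
Qed.

Lemma monic_dvd_eq p P : p \is monic -> P \is monic -> size p = size P -> p %| P -> p = P.
Proof.
move=> mp mP sP pP; apply/eqP; rewrite -eqp_monic //.
by rewrite -dvdp_size_eqp // sP.
Qed.

Lemma comp_mx_cyclic P : P \is monic -> size P = n.+1 ->
  krylov (comp_mx P) (coef_col 1) \in unitmx /\ char_poly (comp_mx P) = P.
Proof.
move=> mP sP; split.
  apply: krylov_unit => p sp; rewrite horner_comp_mx // modp_small ?sP //.
  exact: coef_col_inj.
apply/esym/monic_dvd_eq; rewrite ?char_poly_monic ?size_char_poly //.
apply/eqP/coef_col_inj; first by rewrite -ltnS -sP ltn_modp monic_neq0.
by rewrite -horner_comp_mx // Cayley_Hamilton mul0mx.
Qed.

(** Both matrices are conjugate to the companion matrix of their common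
    characteristic polynomial, by their Krylov matrices. *)
Lemma cyclic_similar A B v w : krylov A v \in unitmx -> krylov B w \in unitmx ->
  char_poly A = char_poly B -> exists2 g, g \in unitmx & A = invmx g *m B *m g.
Proof.
move=> uA uB eqAB; exists (krylov B w *m invmx (krylov A v)).
  by rewrite unitmx_mul uB unitmx_inv.
have DA : A = krylov A v *m comp_mx (char_poly A) *m invmx (krylov A v).
  by rewrite -krylov_comp mulmxK.
rewrite -!mulmxA (mulmxA B) krylov_comp -eqAB.
apply: (canRL (mulKmx _)); first by rewrite unitmx_mul uB unitmx_inv.
by rewrite {2}DA !mulmxA mulmxKV.
Qed.

Lemma similar_cyclic A B v g : krylov A v \in unitmx -> g \in unitmx ->
  B = invmx g *m A *m g ->
  krylov B (invmx g *m v) \in unitmx /\ char_poly B = char_poly A.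
Proof.
move=> uA ug DB; have hornerB p : horner_mx B p = invmx g *m horner_mx A p *m g.
  elim/poly_ind: p => [|p c IHp]; first by rewrite !linear0 ?mulmx0 mul0mx.
  rewrite !(rmorphD, rmorphM) /= !horner_mx_X !horner_mx_C IHp DB.
  rewrite mulmxDr mulmxDl.
  have -> : invmx g *m c%:M *m g = c%:M by rewrite scalar_mxC -mulmxA mulVmx // mulmx1.
  by congr (_ + _); rewrite -!mulmxE !mulmxA mulmxK.
have uB : krylov B (invmx g *m v) \in unitmx.
  apply: krylov_unit => p sp; rewrite hornerB !mulmxA mulmxK // -mulmxA => p0.
  have /(horner_cyclic_eq0 uA) : horner_mx A p *m v = 0.
    by rewrite -[LHS](mulKVmx ug) p0 mulmx0.
  have [-> //|nz] := eqVneq p 0; move/(dvdp_leq nz).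
  by rewrite size_char_poly ltnNge sp.
split=> //; apply: monic_dvd_eq; rewrite ?char_poly_monic ?size_char_poly //.
apply: (horner_cyclic_eq0 uB); rewrite hornerB Cayley_Hamilton.
by rewrite mulmx0 !mul0mx.
Qed.

End CyclicMatrices.

(** * Counting cyclic matrices *)

Section CyclicCount.
Variables (F : finFieldType) (n' : nat).
Local Notation n := n'.+1.
Implicit Types (g h : {'GL_n[F]}) (v : 'cV[F]_n) (P : {poly F}).

Definition GLof (A : 'M[F]_n) : {'GL_n[F]} := insubd (1%g : {'GL_n[F]}) A.

Lemma GLval_inj : injective (@GLval n F).
Proof. exact: val_inj. Qed.

Lemma GLofK (A : 'M[F]_n) : A \in unitmx -> GLval (GLof A) = A.
Proof. by move=> uA; rewrite /GLof val_insubd ifT. Qed.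

Lemma char_poly_coprimeX (A : 'M[F]_n) :
  coprimep (char_poly A) 'X = (A \in unitmx).
Proof.
rewrite coprimepX /root horner_coef0 char_poly_det mulf_eq0 signr_eq0 /=.
by rewrite unitmxE unitfE.
Qed.

Lemma horner_mx_unit (A : 'M[F]_n) (b : {poly F}) :
  coprimep (char_poly A) b -> horner_mx A b \in unitmx.
Proof.
move=> /Bezout_eq1_coprimepP[[u w] /= /(congr1 (horner_mx A))].
rewrite rmorphD !rmorphM rmorph1 /= Cayley_Hamilton mulr0 add0r => wb.
by have [] := mulmx1_unit wb.
Qed.

(** The centralizer of a cyclic matrix [A] is the unit group of the algebra
    [F[A]], isomorphic to [F[X]/(char_poly A)]. *)
Lemma card_centralizer_cyclic g : cyclic_mx (GLval g) ->
  #|'C[g]%g| = unit_count (char_poly (GLval g)).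
Proof.
case/existsP=> v uK; set P := char_poly _.
have sP : (size P).-1 = n by rewrite size_char_poly.
pose S := [set b : {poly_(size P).-1 F} | coprimep P b].
pose f (b : {poly_(size P).-1 F}) := GLof (horner_mx (GLval g) b).
have fE b : b \in S -> GLval (f b) = horner_mx (GLval g) b.
  by rewrite inE => copPb; rewrite GLofK // horner_mx_unit.
have -> : 'C[g]%g = f @: S.
  apply/setP=> h; apply/cent1P/imsetP => [gh | [b Sb ->]].
    have com : GLval g *m GLval h = GLval h *m GLval g.
      by have := congr1 (@GLval _ _) gh; rewrite !GL_MxE.
    have [b sb Db] := comm_cyclic uK com.
    have com' : GLval g *m invmx (GLval h) = invmx (GLval h) *m GLval g.
      apply: (canRL (mulKmx (GL_unitmx h))); rewrite mulmxA -com -mulmxA mulmxV ?mulmx1 //.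
      exact: GL_unitmx.
    have [c sc Dc] := comm_cyclic uK com'.
    have Sb : npolyp (size P).-1 b \in S.
      rewrite inE npolypK ?sP //; apply/Bezout_coprimepP.
      have : P %| c * b - 1.
        apply: (horner_cyclic_eq0 uK); rewrite rmorphB rmorphM rmorph1 /= -Db -Dc.
        by rewrite -mulmxE mulVmx ?(GL_unitmx h) // idmxE subrr mul0mx.
      case/dvdpP=> u Du; exists (- u, c) => /=.
      by rewrite mulNr -Du opprB subrK eqpxx.
    exists (npolyp (size P).-1 b) => //.
    by apply: GLval_inj; rewrite fE // npolypK ?sP.
  by apply: GLval_inj; rewrite !GL_MxE fE //; exact: comm_horner_mx.
rewrite card_in_imset // => b c Sb Sc /(congr1 (@GLval _ _)).
rewrite !fE // => eqbc; apply: npoly_dvd_sub_inj; first by rewrite monic_neq0 ?char_poly_monic.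
by apply: (horner_cyclic_eq0 uK); rewrite rmorphB /= eqbc subrr mul0mx.
Qed.

(** The orbit-stabilizer theorem: these matrices form the conjugacy class of the
    companion matrix of [P]. *)
Lemma card_cyclic_class P : P \is monic -> size P = n.+1 -> coprimep P 'X ->
  (#|[set g : {'GL_n[F]} | cyclic_mx (GLval g) && (char_poly (GLval g) == P)]|
    * unit_count P)%N = #|'GL_n[F]%g|.
Proof.
move=> mP sP copX; have [uK DP] := comp_mx_cyclic mP sP.
pose g := GLof (comp_mx n' P).
have Dg : GLval g = comp_mx n' P by rewrite GLofK // -char_poly_coprimeX DP.
have cyc_g : cyclic_mx (GLval g) by apply/existsP; exists (coef_col n' 1); rewrite Dg.
rewrite -{2}DP -Dg -card_centralizer_cyclic //.
have -> : [set h : {'GL_n[F]} | cyclic_mx (GLval h) && (char_poly (GLval h) == P)]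
   = (g ^: 'GL_n[F])%g.
  apply/setP=> h; rewrite inE; apply/andP/imsetP => [[/existsP[v uv] /eqP DPh] | [x _ ->]].
    have [x ux Dh] := cyclic_similar uv uK (etrans DPh (esym DP)).
    exists (GLof x); first exact: in_setT.
    apply: GLval_inj; rewrite /conjg !GL_MxE GL_VxE GLofK // Dg mulmxA.
    exact: Dh.
  have Dh : GLval (g ^ x)%g = invmx (GLval x) *m comp_mx n' P *m GLval x.
    by rewrite /conjg !GL_MxE GL_VxE Dg mulmxA.
  have [uh Ph] := similar_cyclic uK (GL_unitmx x) Dh.
  split; last by rewrite Ph DP.
  by apply/existsP; eexists; exact: uh.
rewrite -index_cent1 mulnC -[RHS](Lagrange (subsetIl 'GL_n[F]%g 'C[g]%g)).
by congr (_ * _)%N; apply: eq_card => x; rewrite !inE.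
Qed.

(** A root of a cyclic matrix [A] commutes with [A], hence is [b(A)] for some
    [b]; then [b(A) ^+ M = A] says that [b ^+ M] is ['X] modulo the
    characteristic polynomial. *)
Lemma mem_GL_powers M g : cyclic_mx (GLval g) -> (0 < M)%N ->
  (g \in GL_powers F n M) <-> X_is_power M (char_poly (GLval g)).
Proof.
case/existsP=> v uK M0; have expE h k : GLval (h ^+ k)%g = GLval h ^+ k.
  by elim: k => [|k IHk]; rewrite ?expg0 ?expr0 // expgS GL_ME IHk -exprS.
split=> [/imsetP[h _ Dg] | [b Pb]].
  have com : GLval g *m GLval h = GLval h *m GLval g.
    by rewrite Dg expE mulmxE -exprS -exprSr.
  have [b _ Db] := comm_cyclic uK com.
  exists b; apply: (horner_cyclic_eq0 uK).
  rewrite rmorphB rmorphXn /= horner_mx_X -Db Dg expE.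
  by rewrite subrr mul0mx.
have Dg : horner_mx (GLval g) b ^+ M = GLval g.
  apply/eqP; rewrite -subr_eq0 -{2}(horner_mx_X (GLval g)) -rmorphXn -rmorphB /=.
  by rewrite dvdp_char_poly_horner.
have ub : horner_mx (GLval g) b \in unitmx.
  move: (GL_unitmx g); rewrite -[val g]Dg -(prednK M0) exprS.
  by rewrite -mulmxE unitmx_mul => /andP[].
apply/imsetP; exists (GLof (horner_mx (GLval g) b)); first exact: in_setT.
by apply: GLval_inj; rewrite expE GLofK // Dg.
Qed.

(** Sorting the cyclic matrices by their characteristic polynomial. *)
Lemma card_cyclic_powers M (S : pred {poly F}) : (0 < M)%N ->
  #|[set g in GL_powers F n M | cyclic_mx (GLval g) && S (char_poly (GLval g))]|%:R
    / #|'GL_n[F]%g|%:R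
  = \sum_(P : {poly_n.+1 F} | [&& (P : {poly F}) \is monic, size P == n.+1,
      coprimep P 'X, `[< X_is_power M P >] & S P]) (unit_count P)%:R^-1 :> rat.
Proof.
move=> M0; set Z := [set _ in _ | _].
have GL0 : #|'GL_n[F]%g|%:R != 0 :> rat.
  by rewrite pnatr_eq0 -lt0n cardG_gt0.
apply: (mulIf GL0); rewrite mulfVK // mulr_suml.
rewrite -sum1_card natr_sum.
pose h (g : {'GL_n[F]}) : {poly_n.+1 F} := npolyp n.+1 (char_poly (GLval g)).
have hE g : h g = char_poly (GLval g) :> {poly F} by rewrite npolypK ?size_char_poly.
rewrite (partition_big h (fun P : {poly_n.+1 F} => [&& (P : {poly F}) \is monic, size P == n.+1,
      coprimep P 'X, `[< X_is_power M P >] & S P])) /=; last first.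
  move=> g; rewrite inE => /and3P[Mg cyc_g Sg]; rewrite hE char_poly_monic size_char_poly.
  rewrite eqxx char_poly_coprimeX [_ \in unitmx](GL_unitmx g) Sg andbT /=.
  by apply/asboolP; apply/mem_GL_powers.
apply: eq_bigr => P /and5P[mP /eqP sP copX /asboolP powP SP].
rewrite -(card_cyclic_class mP sP copX) natrM mulrC mulfK; last first.
  by rewrite pnatr_eq0 -lt0n unit_count_gt0 // monic_neq0.
rewrite sumr_const; congr (_%:R); apply: eq_card => g; rewrite !inE.
rewrite unfold_in /= inE.
have -> : (h g == P) = (char_poly (GLval g) == P) by rewrite -val_eqE /= hE.
case: (boolP (cyclic_mx _)) => [cyc_g | _]; last by rewrite andbF.
case: eqP => [DP | _]; last by rewrite !andbF.
by rewrite DP SP !andbT; apply/(mem_GL_powers cyc_g M0); rewrite DP.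
Qed.

End CyclicCount.

(** * Regular elements are cyclic *)

Section RegularCyclic.
Variables (F : finFieldType) (n' : nat).
Local Notation n := n'.+1.
Implicit Types (A : 'M[F]_n) (p P : {poly F}) (s : seq {poly F}).

Lemma in_qpoly_eq0 (h p : {poly F}) : h \is monic -> (1 < size h)%N ->
  (in_qpoly h p == 0) = (h %| p).
Proof.
move=> mh sh; rewrite -val_eqE /= /mk_monic mh sh /=.
by rewrite dvdpE.
Qed.

Lemma in_qpoly_eq (h p r : {poly F}) : h \is monic -> (1 < size h)%N ->
  h %| p - r -> in_qpoly h p = in_qpoly h r.
Proof.
move=> mh sh hpr; apply/eqP; rewrite -subr_eq0 -linearB /=.
by rewrite in_qpoly_eq0.
Qed.

Lemma size_monic_prod (I : Type) (s : seq I) (Q : pred I) (E : I -> {poly F}) :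
  (forall i, Q i -> E i \is monic) ->
  (size (\prod_(i <- s | Q i) E i)).-1 = (\sum_(i <- s | Q i) (size (E i)).-1)%N.
Proof.
move=> mE.
suff [] : \prod_(i <- s | Q i) E i \is monic /\
  (size (\prod_(i <- s | Q i) E i)).-1 = (\sum_(i <- s | Q i) (size (E i)).-1)%N by [].
elim/big_ind2: _ => [|k p j r [mp Dp] [mr Dr]|i Qi]; last by split; first exact: mE.
  by rewrite monic1 size_poly1.
split; first by rewrite monicMl.
rewrite size_monicM ?monic_neq0 // -Dp -Dr.
have sp : (0 < size p)%N by rewrite size_poly_gt0 monic_neq0.
have sr : (0 < size r)%N by rewrite size_poly_gt0 monic_neq0.
by rewrite -{1}(prednK sp) -{1}(prednK sr) addnS addSn.
Qed.

Definition coprime_monics s := [/\ all (fun p => p \is monic) s,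
  all (fun p => 1 < size p)%N s &
  forall i j : 'I_(size s), i != j -> coprimep s`_i s`_j].

Lemma dvdp_coprime_monics s p : coprime_monics s ->
  (forall i : 'I_(size s), s`_i %| p) -> \prod_(q <- s) q %| p.
Proof.
case=> _ _ cop dv; rewrite (big_nth 0) big_mkord.
rewrite dvdp_prod_coprime ?index_enum_uniq //; first by apply/allP=> i _; exact: dv.
by move=> i j _ _ _ _; exact: cop.
Qed.

Lemma dvdp_nth_prod s (i : 'I_(size s)) : s`_i %| \prod_(q <- s) q.
Proof. by rewrite (big_nth 0) big_mkord (bigD1 i) //= dvdp_mulr. Qed.

(** Let [v] correspond to the vector of ones in the direct sum.  Then [p(A) v]
    corresponds to the residues of [p], and by coprimality it vanishes exactly
    when the product of [s] divides [p]: so [v] is cyclic. *)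
Lemma module_iso_cyclic A s : coprime_monics s ->
  (size (\prod_(q <- s) q)).-1 = n -> module_iso A s ->
  cyclic_mx A /\ char_poly A = \prod_(q <- s) q.
Proof.
move=> cop_s sn [phi [phiX [psi phiK psiK]]].
have [/allP mon_s /allP size_s _] := cop_s.
pose P := \prod_(q <- s) q.
have mP : P \is monic by rewrite /P big_seq; apply: monic_prod => q /mon_s.
have sP : size P = n.+1.
  by rewrite -sn prednK // size_poly_gt0 monic_neq0.
pose v := psi [ffun i => 1].
have phiv i : phi i v = 1.
  by have /ffunP/(_ i) := psiK [ffun i => 1]; rewrite !ffunE.
have phip i p : phi i (horner_mx A p *m v) = in_qpoly s`_i p.
  elim/poly_ind: p => [|p c IHp]; first by rewrite linear0 mul0mx !linear0.
  rewrite mulrC rmorphD rmorphM /= horner_mx_X horner_mx_C mulmxDl linearD /=.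
  rewrite -mulmxE -mulmxA phiX IHp mul_scalar_mx linearZ /= phiv.
  rewrite linearD /= in_qpolyM; congr (_ + _).
  by rewrite -[c%:P]mulr1 mul_polyC linearZ /= in_qpoly1.
have dvP p : (horner_mx A p *m v == 0) = (P %| p).
  apply/eqP/idP => [p0 | Pp].
    apply: dvdp_coprime_monics => // i.
    by rewrite -in_qpoly_eq0 ?mon_s ?size_s ?mem_nth // -phip p0 linear0.
  apply: (can_inj phiK); apply/ffunP=> i; rewrite !ffunE phip linear0.
  apply/eqP; rewrite in_qpoly_eq0 ?mon_s ?size_s ?mem_nth //.
  exact: dvdp_trans (dvdp_nth_prod i) Pp.
have uK : krylov A v \in unitmx.
  apply: krylov_unit => p sp /eqP; rewrite dvP.
  by have [-> // | nz] := eqVneq p 0; move/(dvdp_leq nz); rewrite sP ltnNge sp.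
split; first by apply/existsP; exists v.
apply: monic_dvd_eq; rewrite ?char_poly_monic ?size_char_poly //.
by apply: (horner_cyclic_eq0 uK); apply/eqP; rewrite dvP.
Qed.

(** For a cyclic vector [v], sending [p(A) v] to the residues of [p] is well
    defined and injective, hence bijective since both sides have [#|F| ^ n]
    elements. *)
Lemma cyclic_module_iso A s : coprime_monics s -> cyclic_mx A ->
  char_poly A = \prod_(q <- s) q -> module_iso A s.
Proof.
move=> cop_s /existsP[v uK] DP.
have [/allP mon_s /allP size_s _] := cop_s.
have mon_i (i : 'I_(size s)) : s`_i \is monic by apply: mon_s; exact: mem_nth.
have size_i (i : 'I_(size s)) : (1 < size (s`_i)%R)%N by apply: size_s; exact: mem_nth.
pose phi (i : 'I_(size s)) : {linear 'cV[F]_n -> {poly %/ s`_i}} :=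
  in_qpoly s`_i \o (@rVpoly F n \o (trmx \o mulmx (invmx (krylov A v)))).
have phip i p : phi i (horner_mx A p *m v) = in_qpoly s`_i p.
  rewrite /phi /= -horner_mx_mod_char_poly -krylov_coef ?size_mod_char_poly //.
  rewrite mulKmx //.
  have -> : rVpoly (coef_col n' (p %% char_poly A))^T = p %% char_poly A.
    rewrite -[RHS](@poly_rV_K _ n) ?size_mod_char_poly //; congr rVpoly.
    by apply/rowP=> j; rewrite !mxE.
  apply: in_qpoly_eq => //; apply: (@dvdp_trans _ (char_poly A)).
    by rewrite DP dvdp_nth_prod.
  rewrite [X in _ - X](divp_eq p (char_poly A)) opprD addrCA subrr addr0 dvdpNr.
  exact: dvdp_mull.
exists phi; split=> [i w|].
  have [p _ ->] := cyclic_span w uK.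
  have -> : A *m (horner_mx A p *m v) = horner_mx A ('X * p) *m v.
    by rewrite mulmxA rmorphM /= horner_mx_X.
  by rewrite !phip in_qpolyM.
apply: inj_card_bij.
  move=> w1 w2; have [p _ ->] := cyclic_span w1 uK; have [r _ ->] := cyclic_span w2 uK.
  move/ffunP=> eq_pr; apply/eqP; rewrite -subr_eq0 -mulmxBl -rmorphB /=.
  rewrite dvdp_char_poly_horner ?mul0mx // DP; apply: dvdp_coprime_monics => // i.
  by have := eq_pr i; rewrite !ffunE !phip => /eqP; rewrite -subr_eq0 -linearB in_qpoly_eq0.
rewrite card_mx muln1 card_dep_ffun foldrE big_image /=.
have -> : n = (\sum_(i < size s) (size (s`_i)%R).-1)%N.
  have := size_char_poly A; rewrite DP (big_nth 0) big_mkord => /(congr1 predn) /= <-.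
  by rewrite size_monic_prod.
rewrite expn_sum leq_prod // => i _.
by rewrite card_monic_qpoly.
Qed.

(** Regularity with all part sizes in [J]; [J] is everything for the regular
    elements and [pred1 1] for the regular semisimple ones. *)
Definition regular_in (J : pred nat) A := exists2 D, has_comb_data A D &
  forall fl, fl \in D -> exists2 k, J k & fl.2 = [:: k].

Lemma elem_divisors_regular (D : comb_data F) (e : nat -> nat) :
  (forall i, (i < size D)%N -> (nth (0, [::]) D i).2 = [:: e i]) ->
  elem_divisors D = [seq (nth (0, [::]) D i).1 ^+ e i | i <- iota 0 (size D)].
Proof.
move=> De; rewrite /elem_divisors -{1}(mkseq_nth (0, [::]) D) /mkseq.
have: all (fun i => i < size D)%N (iota 0 (size D)).
  by apply/allP=> i; rewrite mem_iota.
elim: (iota _ _) => //= i r IHr /andP[ltiD /IHr ->].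
by rewrite De.
Qed.

(** Regular elements are cyclic since the elementary divisors are pairwise
    coprime, and the parts are the multiplicities of the characteristic
    polynomial, which is the product of the elementary divisors. *)
Lemma regular_in_cyclic (J : pred nat) A : regular_in J A -> cyclic_mx A /\
  (forall f, irreducible_poly f -> f \is monic ->
     f %| char_poly A -> J (mult f (char_poly A))).
Proof.
case=> D [[uniqD PhiD partD sumD] isoA] regD.
pose d0 : {poly F} * seq nat := (0, [::]).
pose f (i : 'I_(size D)) := (nth d0 D i).1.
pose e i := head 0%N (nth d0 D i).2.
have memD (i : 'I_(size D)) : nth d0 D i \in D by exact: mem_nth.
have De i : (i < size D)%N -> (nth d0 D i).2 = [:: e i].
  by move=> ltiD; rewrite /e; have [k _ ->] := regD _ (mem_nth d0 ltiD).
have Je (i : 'I_(size D)) : J (e i).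
  by have [k Jk Dk] := regD _ (memD i); rewrite /e Dk.
have e_gt0 (i : 'I_(size D)) : (0 < e i)%N.
  have /andP[/andP[_]] := partD _ (memD i).
  by rewrite De // inE eq_sym -lt0n.
have irr_f i : irreducible_poly (f i) /\ f i \is monic.
  by have [] := PhiD _ (memD i).
have inj_f : injective f.
  move=> i j eq_fij; apply/val_inj/eqP.
  rewrite -(nth_uniq 0 _ _ uniqD) ?size_map ?ltn_ord //.
  by rewrite !(nth_map d0) ?ltn_ord //; apply/eqP.
have divE := elem_divisors_regular De.
have size_div : size (elem_divisors D) = size D by rewrite divE size_map size_iota.
have nth_div i : (i < size D)%N -> (elem_divisors D)`_i = (nth d0 D i).1 ^+ e i.
  by move=> ltiD; rewrite divE (nth_map 0%N) ?size_iota // nth_iota.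
have prodE : \prod_(q <- elem_divisors D) q = \prod_i f i ^+ e i.
  by rewrite (big_nth 0) size_div big_mkord; apply: eq_bigr => i _; rewrite nth_div.
have cop : coprime_monics (elem_divisors D).
  split.
  - apply/(all_nthP 0)=> i; rewrite size_div => ltiD; rewrite nth_div //.
    exact: monic_exp (irr_f (Ordinal ltiD)).2.
  - apply/(all_nthP 0)=> i; rewrite size_div => ltiD; rewrite nth_div //.
    have := ltn_size_exp (e i) (irr_f (Ordinal ltiD)).1.1.
    exact: leq_ltn_trans (e_gt0 (Ordinal ltiD)).
  move=> [i ltis] [j ltjs] neij /=; move: (ltis) (ltjs); rewrite size_div => lti ltj.
  rewrite !nth_div //; apply/coprimep_expl/coprimep_expr.
  have [irr_i mi] := irr_f (Ordinal lti); have [irr_j mj] := irr_f (Ordinal ltj).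
  apply: monic_irredp_coprime => //; apply: contraNneq neij => eqij.
  have : f (Ordinal lti) = f (Ordinal ltj) by [].
  by move/inj_f=> [eq_ij]; apply/eqP/val_inj.
have size_prod : (size (\prod_(q <- elem_divisors D) q)).-1 = n.
  rewrite -[RHS]sumD prodE size_monic_prod; last first.
    by move=> i _; apply: monic_exp (irr_f i).2.
  rewrite (big_nth d0) big_mkord; apply: eq_bigr => i _.
  by rewrite De //= addn0 size_exp mulnC.
have [cycA DP] := module_iso_cyclic cop size_prod isoA; split=> // g irr_g mg.
rewrite DP prodE => g_dvd.
case: (pickP (fun i => f i == g)) => [i /eqP <- | neq_f].
  by rewrite (mult_prod (Q := predT)) // => j _; apply: irr_f.
have : (0 < mult g (\prod_i f i ^+ e i))%N.
  rewrite mult_gt0 //; first exact: irr_g.1.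
  by rewrite monic_neq0 // -prodE -DP char_poly_monic.
rewrite (mult_prod0 (Q := predT)) // => j _.
by rewrite neq_f.
Qed.

(** The combinatorial data is the factorization of the characteristic
    polynomial; invertibility keeps ['X] out of it. *)
Lemma cyclic_regular_in (J : pred nat) A : A \in unitmx -> cyclic_mx A ->
  (forall f, irreducible_poly f -> f \is monic ->
     f %| char_poly A -> J (mult f (char_poly A))) ->
  regular_in J A.
Proof.
move=> uA cycA JA.
set P := char_poly A in JA *.
have mP : P \is monic by exact: char_poly_monic.
have sP : size P = n.+1 by exact: size_char_poly.
have P0 : P != 0 by exact: monic_neq0.
pose I := {poly_n.+1 F}.
pose s := [seq f <- enum I | irr_monic (f : I) && ((f : {poly F}) %| P)].
pose D : comb_data F := [seq ((f : {poly F}), [:: mult f P]) | f : I <- s].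
have sE f : f \in s -> [/\ irreducible_poly (f : {poly F}), (f : {poly F}) \is monic & (f : {poly F}) %| P].
  by rewrite mem_filter => /andP[/andP[/irr_monicP[irr_f mf] fP] _].
have divD : elem_divisors D = [seq (f : {poly F}) ^+ mult f P | f : I <- s].
  by rewrite /elem_divisors /D; elim: (s) => //= f r ->.
have us : uniq s by rewrite filter_uniq ?enum_uniq.
have m_gt0 f : f \in s -> (0 < mult f P)%N.
  by case/sE=> irr_f _ fP; rewrite mult_gt0 //; exact: irr_f.1.
have cop : coprime_monics (elem_divisors D).
  rewrite divD; split.
  - by apply/allP=> _ /mapP[f /sE[_ mf _] ->]; apply: monic_exp.
  - apply/allP=> _ /mapP[f sf ->]; have [irr_f _ _] := sE f sf.
    by have := ltn_size_exp (mult f P) irr_f.1; apply: leq_ltn_trans (m_gt0 f sf).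
  move=> [i ltis] [j ltjs] neij /=; move: (ltis) (ltjs); rewrite size_map => lti ltj.
  rewrite !(nth_map 0) //; apply/coprimep_expl/coprimep_expr.
  have [irr_i mi _] := sE _ (mem_nth 0 lti); have [irr_j mj _] := sE _ (mem_nth 0 ltj).
  apply: monic_irredp_coprime => //; apply: contraNneq neij => /val_inj/eqP.
  by rewrite nth_uniq // => /eqP eqij; apply/eqP/val_inj.
have prodD : P = \prod_(q <- elem_divisors D) q.
  rewrite divD big_map {1}(prod_mult_npoly mP (eq_leq sP)) big_filter big_enum_cond /=.
  rewrite (bigID (fun f : I => (f : {poly F}) %| P)) /= [X in _ * X]big1 ?mulr1 //.
  move=> f /andP[/irr_monicP[irr_f _]].
  by rewrite -(mult_gt0 irr_f.1 P0) -eqn0Ngt => /eqP ->.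
exists D; last first.
  move=> _ /mapP[f /sE[irr_f mf fP] ->]; exists (mult f P) => //.
  exact: JA.
split; last exact: cyclic_module_iso.
split.
- by rewrite /D /unzip1 -map_comp map_inj_uniq //; exact: val_inj.
- move=> _ /mapP[f /sE[irr_f mf fP] ->]; split=> //=.
  have copPX : coprimep P 'X by rewrite char_poly_coprimeX.
  apply/eqP=> Df; have := coprimep_dvdr fP copPX.
  by rewrite Df coprimepp size_polyX.
- move=> _ /mapP[f sf ->]; rewrite /int_partition /= !inE !andbT.
  by rewrite eq_sym -lt0n m_gt0.
transitivity (size (\prod_(q <- elem_divisors D) q)).-1; last by rewrite -prodD sP.
rewrite divD !big_map big_seq [\prod_(_ <- s) _]big_seq size_monic_prod; last first.
  by move=> f /sE[_ mf _]; apply: monic_exp.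
by apply: eq_bigr => f _; rewrite /= addn0 size_exp mulnC.
Qed.

Lemma regular_inP J A : A \in unitmx ->
  regular_in J A <-> cyclic_mx A /\ (forall f, irreducible_poly f -> f \is monic ->
    f %| char_poly A -> J (mult f (char_poly A))).
Proof.
move=> uA; split=> [|[cycA JA]]; first exact: regular_in_cyclic.
exact: cyclic_regular_in.
Qed.

End RegularCyclic.

(** * Infinite products of power series *)

Section FpsProducts.
Variable R : fieldType.
Implicit Types (f g : {fps R}) (E : nat -> {fps R}).
Local Notation u := (fpsX R).

Lemma fpsXnM d f n : (u ^+ d * f) n = if (d <= n)%N then f (n - d)%N else 0.
Proof.
rewrite fpsME; case: leqP => [ledn | ltnd].
  have ltdn : (d < n.+1)%N by [].
  rewrite (bigD1 (Ordinal ltdn)) //= fpsXnE eqxx mul1r big1 ?addr0 // => i neid.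
  by rewrite fpsXnE (negPf (_ : (i : nat) != d)) ?mul0r.
rewrite big1 // => i _; rewrite fpsXnE ltn_eqF ?mul0r //.
exact: leq_ltn_trans (ltnSE (ltn_ord i)) ltnd.
Qed.

Lemma eq_fpsM_upto n f f' g g' : (forall i, (i <= n)%N -> f i = f' i) ->
  (forall i, (i <= n)%N -> g i = g' i) -> forall i, (i <= n)%N -> (f * g) i = (f' * g') i.
Proof.
move=> ff' gg' i lein; rewrite !fpsME; apply: eq_bigr => j _.
have lej : (j <= i)%N by rewrite -ltnS.
by rewrite ff' ?gg' // ?(leq_trans (leq_subr _ _)) // (leq_trans lej).
Qed.

Lemma eq_fps_prod_upto n (I : Type) (s : seq I) (Q : pred I) (G H : I -> {fps R}) :
  (forall j, Q j -> forall i, (i <= n)%N -> G j i = H j i) ->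
  forall i, (i <= n)%N -> (\prod_(j <- s | Q j) G j) i = (\prod_(j <- s | Q j) H j) i.
Proof.
move=> GH; elim: s => [|j s IHs] i lein; first by rewrite !big_nil.
by rewrite !big_cons; case: ifP => Qj; [apply: eq_fpsM_upto lein => //; apply: GH | apply: IHs].
Qed.

Lemma infsum_coef E n : (forall i m, (m < i)%N -> E i m = 0) ->
  infsum 1 E n = \sum_(1 <= i < n.+1) E i n.
Proof.
move=> E0; have [N DN] := infsum_cvg 1 E0 n.
rewrite -(DN (maxn N n.+1)) ?leq_maxl // fps_sumE.
rewrite (@big_cat_nat _ _ _ n.+1) ?leq_maxr //= [X in _ + X]big_nat_cond.
by rewrite [X in _ + X]big1 ?addr0 // => i /andP[/andP[/E0]].
Qed.

Lemma one_add_infsum (a : nat -> R) n :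
  (1 + infsum 1 (fun i => a i *: u ^+ i)) n = if n is 0 then 1 else a n.
Proof.
rewrite fpsDE infsum_coef => [|i m ltmi]; last by rewrite fpsZE fpsXnE ltn_eqF ?mulr0.
case: n => [|n]; first by rewrite big_nil fps1E addr0.
rewrite fps1E add0r big_nat_recr // fpsZE fpsXnE eqxx mulr1 big_nat_cond.
rewrite big1 => [|i /andP[/andP[_ ltin] _]]; first exact: add0r.
by rewrite fpsZE fpsXnE gtn_eqF ?mulr0.
Qed.

(** [f] is 1 modulo [u ^+ d].  A product whose [d]-th factor has this property
    converges, the coefficient of [u ^+ n] being settled after [n] factors. *)
Definition one_mod d f := exists g, f = 1 + u ^+ d * g.

Lemma one_modZ d (c : R) : one_mod d (1 + c *: u ^+ d).
Proof. by exists c%:A; rewrite [u ^+ d * _]mulrC -scalerAl mul1r. Qed.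

Lemma one_modM d f g : one_mod d f -> one_mod d g -> one_mod d (f * g).
Proof.
move=> [f' ->] [g' ->]; exists (f' + g' + u ^+ d * f' * g'); ring.
Qed.

Lemma one_modX d f k : one_mod d f -> one_mod d (f ^+ k).
Proof.
move=> df; elim: k => [|k IHk]; last by rewrite exprS; apply: one_modM.
by exists 0; rewrite expr0 mulr0 addr0.
Qed.

Lemma one_mod_unit d f : (0 < d)%N -> one_mod d f -> f \is a GRing.unit.
Proof.
move=> d0 [g ->]; rewrite unfold_in /= /fps_unit fpsDE fpsXnM leqNgt d0 addr0.
by rewrite fps1E oner_neq0.
Qed.

Lemma one_modV d f : (0 < d)%N -> one_mod d f -> one_mod d f^-1.
Proof.
move=> d0 df; have uf := one_mod_unit d0 df; have [g Df] := df.
exists (- g * f^-1); apply: (mulIr uf); rewrite mulVr // mulrDl mul1r.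
by rewrite -!mulrA mulVr // mulr1 {1}Df mulrN addrK.
Qed.

Lemma one_mod_prod_stable E n k : (forall d, (0 < d)%N -> one_mod d (E d)) ->
  (n < k)%N -> (\prod_(1 <= d < k) E d) n = (\prod_(1 <= d < n.+1) E d) n.
Proof.
move=> oneE ltnk; rewrite (@big_cat_nat _ _ _ n.+1) //=.
rewrite -[RHS](congr1 (fun f : {fps R} => f n) (mulr1 _)).
apply: (@eq_fpsM_upto n) => // i lein.
rewrite big_nat; transitivity ((\prod_(n.+1 <= j < k | (n < j < k)%N) (1 : {fps R})) i).
  apply: (@eq_fps_prod_upto n) => // d /andP[ltnd _] j lejn.
  have [g ->] := oneE d (leq_ltn_trans (leq0n _) ltnd).
  by rewrite fpsDE fpsXnM leqNgt (leq_ltn_trans lejn ltnd) addr0.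
by rewrite big1.
Qed.

Lemma infprod_coef E n : (forall d, (0 < d)%N -> one_mod d (E d)) ->
  infprod 1 E n = (\prod_(1 <= d < n.+1) E d) n.
Proof.
move=> oneE; pose s := Fps (fun n => (\prod_(1 <= d < n.+1) E d) n).
suff -> : infprod 1 E = s by [].
by apply: fps_cvg_lim => m; exists m.+1 => k ltmk; apply: one_mod_prod_stable.
Qed.

Lemma infprodM E E' : (forall d, (0 < d)%N -> one_mod d (E d)) ->
  (forall d, (0 < d)%N -> one_mod d (E' d)) ->
  infprod 1 (fun d => E d * E' d) = infprod 1 E * infprod 1 E'.
Proof.
move=> oneE oneE'; apply: fpsP => n.
rewrite infprod_coef; last by move=> d d0; apply: one_modM; [apply: oneE | apply: oneE'].
rewrite big_split /=; apply: (@eq_fpsM_upto n) => // i lein.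
  by rewrite infprod_coef // one_mod_prod_stable.
by rewrite infprod_coef // one_mod_prod_stable.
Qed.

Lemma eq_infprod E E' : (forall d, (0 < d)%N -> E d = E' d) ->
  infprod 1 E = infprod 1 E'.
Proof.
move=> eqE; congr fps_lim; apply/funext => k.
by rewrite !big_nat; apply: eq_bigr => i /andP[/eqE].
Qed.

End FpsProducts.

(** * Euler product *)

Section EulerProduct.
Variables (F : finFieldType) (M : nat) (J : pred nat).
Hypotheses (copM : coprime #|F| M) (M0 : (0 < M)%N).
Local Notation u := (fpsX rat).
Local Notation Q := (#|F|%:R : rat).

(** The weight of [f ^+ j] in the Euler product, for [f] of degree [d]: the
    inverse of the order of the unit group of [F[X]/(f ^+ j)] if [j] is zero or
    an allowed multiplicity, and zero otherwise. *)
Definition weight d j : rat :=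
  if j is j'.+1 then (J j)%:R * (Q ^+ (j' * d) * (Q ^+ d - 1))^-1 else 1.

(** The sum of [weight d j *: u ^+ (j * d)] over all [j], by coefficients. *)
Definition local_factor d : {fps rat} :=
  Fps (fun n => if (d %| n)%N then weight d (n %/ d) else 0).

Lemma local_factorE d n :
  local_factor d n = if (d %| n)%N then weight d (n %/ d) else 0.
Proof. by []. Qed.

Lemma local_factor_trunc K d n : (0 < d)%N -> (n <= K)%N ->
  local_factor d n = (\sum_(j < K.+1) weight d j *: u ^+ (j * d)) n.
Proof.
move=> d0 lenK; rewrite fps_sumE local_factorE; case: ifPn => [dn | ndn]; last first.
  rewrite big1 // => j _; rewrite fpsZE fpsXnE.
  by case: eqP => [Dn|_]; [rewrite Dn dvdn_mull in ndn | rewrite mulr0].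
have ltK : (n %/ d < K.+1)%N by rewrite ltnS (leq_trans (leq_div _ _)).
rewrite (bigD1 (Ordinal ltK)) // fpsZE fpsXnE divnK // eqxx mulr1.
rewrite big1 => [|j nej]; first by rewrite [RHS]addr0.
rewrite fpsZE fpsXnE; case: eqP => [Dn|_]; last by rewrite mulr0.
by case/eqP: nej; apply: val_inj; rewrite /= Dn mulnK.
Qed.

Lemma inv_unit_count f j : irreducible_poly f -> J j || (j == 0)%N ->
  (unit_count (f ^+ j))%:R^-1 = weight (size (f : {poly F})).-1 j.
Proof.
move=> irr_f; case: j => [_ | j]; first by rewrite expr0 unit_count1 invr1.
rewrite orbF => Jj; rewrite unit_countX //= Jj mul1r.
have q0 : (0 < #|F| ^ (size f).-1)%N by rewrite expn_gt0 (ltnW (card_finNzRing_gt1 F)).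
by rewrite natrM natrB // !natrX.
Qed.

Definition good (f : {poly F}) := `[< f <> 'X /\ M_power_poly M f >].

(** The monic polynomials with this property are the characteristic polynomials
    of the matrices that are counted; it rules out ['X], hence singular
    matrices. *)
Definition admissible (P : {poly F}) := `[< forall f, irreducible_poly f ->
  f \is monic -> f %| P -> good f /\ J (mult f P) >].

(** The coefficients up to degree [K] only involve irreducible polynomials of
    degree at most [K] and exponents at most [K]; expanding the finite product
    over them gives a sum over exponent vectors. *)
Section Truncation.
Variable K : nat.
Local Notation T := {poly_K.+1 F}.
Implicit Types e : {ffun T -> 'I_K.+1}.

Definition good_prime (f : T) := irr_monic f && good f.

Let deg (f : T) := (size (f : {poly F})).-1.

Let of_exp (e : {ffun T -> 'I_K.+1}) : {poly F} :=
  \prod_(f | good_prime f) (f : {poly F}) ^+ e f.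

Let goodP (f : T) : good_prime f ->
  irreducible_poly (f : {poly F}) /\ (f : {poly F}) \is monic.
Proof. by case/andP=> /irr_monicP. Qed.

Let monic_of_exp e : of_exp e \is monic.
Proof. by apply: monic_prod => f /goodP[_ mf]; apply: monic_exp. Qed.

Let size_of_exp e : (size (of_exp e)).-1 = (\sum_(f | good_prime f) e f * deg f)%N.
Proof.
rewrite size_monic_prod => [|f /goodP[_ mf]]; last exact: monic_exp.
by apply: eq_bigr => f _; rewrite size_exp mulnC.
Qed.

Let mult_of_exp e f : good_prime f -> mult f (of_exp e) = e f.
Proof.
by move=> gf; apply: (mult_prod (fun f => nat_of_ord (e f)) (@val_inj _ _ T) goodP).
Qed.

Let dvd_of_exp e g : irreducible_poly g -> g \is monic -> g %| of_exp e ->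
  exists2 f : T, good_prime f & f = g :> {poly F}.
Proof.
move=> irr_g mg; rewrite -mult_gt0 ?monic_neq0 //; last exact: irr_g.1.
case: (pickP (fun f : T => good_prime f && ((f : {poly F}) == g))).
  by move=> f /andP[gf /eqP]; exists f.
move=> neg; rewrite (mult_prod0 (Q := good_prime)) // => f gf.
by have := neg f; rewrite gf /= => ->.
Qed.

Let size_of_expE n (e : {ffun T -> 'I_K.+1}) : (\sum_(f | good_prime f) e f * deg f = n)%N ->
  size (of_exp e) = n.+1.
Proof. by move=> <-; rewrite -size_of_exp prednK // size_poly_gt0 monic_neq0. Qed.

Let allowed (e : {ffun T -> 'I_K.+1}) :=
  [forall (f | good_prime f), J (e f) || (e f == 0 :> nat)].

Let admissible_of_exp e : admissible (of_exp e) <-> allowed e.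
Proof.
have nz := monic_neq0 (monic_of_exp e).
split=> [/asboolP adm | /forall_inP Je].
  apply/forall_inP=> f gf; have [irr_f mf] := goodP gf.
  case: posnP => [->|]; first by rewrite orbT.
  rewrite -mult_of_exp // orbF mult_gt0 //; last exact: irr_f.1.
  by move=> /(adm _ irr_f mf)[].
apply/asboolP=> g irr_g mg gP; have [f gf Df] := dvd_of_exp irr_g mg gP.
have := Je f gf; rewrite -mult_of_exp // Df.
move: gP; rewrite -mult_gt0 //; last exact: irr_g.1.
by case: (mult g _) => // m _; rewrite orbF -Df; case/andP: gf.
Qed.

Let exp_of n (P : {poly_n.+1 F}) : {ffun T -> 'I_K.+1} :=
  [ffun f => if good_prime f then inord (mult f P) else ord0].

Let exp_ofK n (P : {poly_n.+1 F}) : (n <= K)%N -> (P : {poly F}) \is monic ->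
  admissible P -> of_exp (exp_of P) = P.
Proof.
move=> lenK mP /asboolP adm; have P0 := monic_neq0 mP.
have sP : (size P <= n.+1)%N := size_npoly P.
rewrite [RHS](@prod_mult _ _ good_prime (@polyn _ _)) //; first last.
- move=> f irr_f mf fP.
  have [g irr_g Dg] : exists2 g : T, irr_monic g & g = f :> {poly F}.
    by apply: irr_monic_npoly => //; rewrite (leq_trans (dvdp_leq P0 fP)) // (leq_trans sP).
  by exists g => //; rewrite /good_prime irr_g Dg; case: (adm f).
- exact: val_inj.
apply: eq_bigr => f gf; rewrite ffunE gf inordK //.
have [irr_f _] := goodP gf; have sf := irr_f.1.
have dv : (f : {poly F}) ^+ mult f P %| P by rewrite -leq_mult.
rewrite (leq_trans (ltn_size_exp _ sf)) // (leq_trans (dvdp_leq P0 dv)) //.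
by rewrite (leq_trans sP).
Qed.

Let unit_count_of_exp e : allowed e ->
  (unit_count (of_exp e))%:R^-1 = \prod_(f | good_prime f) weight (deg f) (e f).
Proof.
move=> /forall_inP Je; rewrite unit_count_prod ?index_enum_uniq //; first last.
- by move=> f /goodP[_ mf]; rewrite monic_neq0 // monic_exp.
- move=> f g _ _ /goodP[irr_f mf] /goodP[irr_g mg] nefg.
  by apply/coprimep_expl/coprimep_expr/monic_irredp_coprime.
rewrite natr_prod -prodfV; apply: eq_bigr => f gf.
by have [irr_f _] := goodP gf; rewrite inv_unit_count // Je.
Qed.

(** Unique factorization matches the polynomials of degree [n] with the
    exponent vectors of degree [n]. *)
Lemma sum_admissible n : (n <= K)%N ->
  \sum_(P : {poly_n.+1 F} | [&& (P : {poly F}) \is monic, size P == n.+1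
      & admissible P]) (unit_count P)%:R^-1
  = \sum_(e in pfamily (@ord0 K) good_prime (fun=> predT : pred 'I_K.+1) |
      (\sum_(f | good_prime f) e f * deg f)%N == n)
      \prod_(f | good_prime f) weight (deg f) (e f) :> rat.
Proof.
move=> lenK; rewrite [RHS](bigID allowed) /=.
rewrite [X in _ + X]big1 ?addr0 => [|e /andP[_ /forall_inPn[f gf]]]; last first.
  (* A forbidden multiplicity has weight zero. *)
  rewrite negb_or => /andP[nJ nz]; rewrite (bigD1 f) //= /weight.
  by case: (nat_of_ord (e f)) nJ nz => [|j] // /negPf -> _; rewrite !mul0r.
pose h (e : {ffun T -> 'I_K.+1}) : {poly_n.+1 F} := npolyp n.+1 (of_exp e).
rewrite (reindex_onto h (@exp_of n)) /=; last first.
  by move=> P /and3P[mP _ adm]; rewrite /h exp_ofK //; apply/val_inj/npolypK/size_npoly.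
have hE (e : {ffun T -> 'I_K.+1}) : (\sum_(f | good_prime f) e f * deg f = n)%N -> h e = of_exp e :> {poly F}.
  by move=> /size_of_expE se; rewrite npolypK ?se.
apply: eq_big => [e | e]; last first.
  case/andP=> /and3P[mh /eqP sh adm] /eqP De.
  have Dh : of_exp e = h e by rewrite -{1}De exp_ofK.
  by rewrite -Dh unit_count_of_exp //; apply/admissible_of_exp; rewrite Dh.
apply/idP/idP => [/andP[/and3P[mh /eqP sh adm] /eqP De] | /andP[/andP[/pfamilyP[supp _] /eqP De] al]].
  have Dh : of_exp e = h e by rewrite -{1}De exp_ofK.
  apply/andP; split; last by apply/admissible_of_exp; rewrite Dh.
  rewrite -size_of_exp Dh sh eqxx andbT; apply/pfamilyP; split=> //.
  apply/fintype.subsetP => f; rewrite inE -De ffunE; apply: contraR => ngf.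
  by rewrite ifN.
rewrite hE // monic_of_exp (size_of_expE De) eqxx /=.
rewrite (_ : admissible _) /=; last exact/admissible_of_exp.
apply/eqP/ffunP=> f; rewrite ffunE; case: ifP => [gf | ngf].
  by apply: val_inj; rewrite /= hE // mult_of_exp // inord_val.
apply/esym/eqP; apply: contraFT ngf => nz.
by have := fintype.subsetP supp f; rewrite inE => /(_ nz).
Qed.

Lemma prod_local_factor_coef n : (n <= K)%N ->
  (\prod_(f | good_prime f) local_factor (deg f)) n =
  \sum_(P : {poly_n.+1 F} | [&& (P : {poly F}) \is monic, size P == n.+1
      & admissible P]) (unit_count P)%:R^-1.
Proof.
move=> lenK; rewrite sum_admissible //.
transitivity ((\prod_(f | good_prime f)
     \sum_(j < K.+1) weight (deg f) j *: u ^+ (j * deg f)) n).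
  apply: (@eq_fps_prod_upto _ n) => // f gf i lein.
  apply: local_factor_trunc; last exact: leq_trans lein lenK.
  by have [irr_f _] := goodP gf; rewrite /deg -ltnS prednK ?irr_f.1 // ltnW ?irr_f.1.
rewrite (big_distr_big_dep (@ord0 K)) fps_sumE big_mkcondr /=; apply: eq_bigr => e _.
have -> : \prod_(f | good_prime f) (weight (deg f) (e f) *: u ^+ (e f * deg f)) =
    (\prod_(f | good_prime f) weight (deg f) (e f)) *:
      u ^+ (\sum_(f | good_prime f) e f * deg f).
  elim/big_rec3: _ => [|f k w x _ ->]; first by rewrite expr0 scale1r.
  by rewrite -scalerAl (mulrC (u ^+ _)) -scalerAl scalerA -exprD addnC.
rewrite fpsZE fpsXnE eq_sym; case: eqP => _; by rewrite ?mulr1 ?mulr0.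
Qed.

Lemma prod_local_factor_deg :
  \prod_(f | good_prime f) local_factor (deg f)
  = \prod_(1 <= d < K.+1) local_factor d ^+ N_power F M d.
Proof.
have deg_bounds f : good_prime f -> (0 < deg f < K.+1)%N.
  move=> /goodP[irr_f _]; have sf := irr_f.1; rewrite /deg -subn1 subn_gt0 sf /=.
  by rewrite ltnS leq_subLR add1n size_npoly.
rewrite big_geq_mkord /=.
rewrite (partition_big (fun f => inord (deg f) : 'I_K.+1) (fun d => 0 < d)%N) /=; last first.
  by move=> f /deg_bounds/andP[d0 dK]; rewrite inordK.
apply: eq_bigr => d d0.
rewrite (eq_bigr (fun=> local_factor d)) => [|f /andP[/deg_bounds/andP[_ dK] /eqP <-]]; last first.
  by rewrite inordK.
rewrite prodr_const; congr (_ ^+ _).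
have ledK : (d.+1 <= K.+1)%N by exact: ltn_ord.
pose lift (f : {poly_d.+1 F}) : T := npolyp K.+1 f.
have liftE (f : {poly_d.+1 F}) : lift f = f :> {poly F}.
  by rewrite npolypK // (leq_trans (size_npoly f)).
have inj_lift : injective lift.
  by move=> f g /(congr1 (@polyn _ _)); rewrite !liftE => /val_inj.
rewrite /N_power -(card_imset _ inj_lift); apply: eq_card => f.
rewrite unfold_in /=; apply/andP/imsetP => [[gf /eqP Df] | [g]].
  have df : deg f = d by rewrite -Df inordK //; case/andP: (deg_bounds f gf).
  have [irr_f mf] := goodP gf.
  have sf : size (f : {poly F}) = d.+1 by rewrite -df prednK // ltnW ?irr_f.1.
  have Dg : npolyp d.+1 f = f :> {poly F} by rewrite npolypK ?sf.
  exists (npolyp d.+1 f); last by apply: val_inj; rewrite /= liftE Dg.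
  rewrite inE; apply/asboolP; rewrite Dg; case/andP: gf => _ /asboolP[neX Mf].
  by split=> //; split=> //; apply/eqP.
rewrite inE => /asboolP[sg [irr_g mg neX] Mg] ->; split.
  rewrite /good_prime; apply/andP; split; first by apply/irr_monicP; rewrite liftE.
  by apply/asboolP; rewrite liftE; split=> //; apply/eqP.
by apply/eqP/val_inj; rewrite /= inordK /deg liftE sg.
Qed.
End Truncation.

Definition regular_powers n : {set {'GL_n[F]}} :=
  [set g in GL_powers F n M | `[< regular_in J (GLval g) >]].

Lemma card_regular_powers n :
  #|regular_powers n.+1|%:R / #|'GL_n.+1[F]%g|%:R
  = \sum_(P : {poly_n.+2 F} | [&& (P : {poly F}) \is monic, size P == n.+2
      & admissible P]) (unit_count P)%:R^-1 :> rat.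
Proof.
pose S (P : {poly F}) := `[< forall f, irreducible_poly f -> f \is monic ->
   f %| P -> J (mult f P) >].
transitivity (#|[set g in GL_powers F n.+1 M |
    cyclic_mx (GLval g) && S (char_poly (GLval g))]|%:R / #|'GL_n.+1[F]%g|%:R : rat).
  congr (_%:R / _); apply: eq_card => g; rewrite !inE; congr (_ && _).
  apply/asboolP/andP=> [/(regular_inP _ (GL_unitmx g))[cg Jg] | [cg /asboolP Jg]].
    by split=> //; apply/asboolP.
  exact/(regular_inP _ (GL_unitmx g)).
rewrite card_cyclic_powers //; apply: eq_bigl => P.
case mP: ((P : {poly F}) \is monic) => //=; case: eqP => //= sP.
apply/and3P/asboolP => [[copX /asboolP powP /asboolP JP] f irr_f mf fP | adm].
  split; last exact: JP.
  apply/asboolP; split; last by apply: (iffLR (X_is_power_irr copM M0 mP copX)) fP.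
  move=> DX; move: fP; rewrite DX => XP.
  by have := coprimep_dvdr XP copX; rewrite coprimepp size_polyX.
have irrX : irreducible_poly ('X : {poly F}) by rewrite -['X]subr0; apply: irredp_XsubC.
have copX : coprimep P 'X.
  rewrite coprimep_sym; apply: irredp_ndvd_coprime => //.
  by apply/negP=> XP; have [/asboolP[]] := adm 'X irrX (monicX F) XP.
split=> //; apply/asboolP; last by move=> f irr_f mf fP; case: (adm f irr_f mf fP).
apply/(X_is_power_irr copM M0 mP copX) => f irr_f mf fP.
by have [/asboolP[]] := adm f irr_f mf fP.
Qed.

(** For [k > n], the coefficient of [u ^+ n] in the product of the factors of
    index less than [k] sums the inverse unit counts over the admissible
    polynomials of degree [n], which is the proportion of matrices counted. *)
Lemma euler_product :
  1 + infsum 1 (fun n => (#|regular_powers n|%:R / #|'GL_n[F]%g|%:R) *: u ^+ n)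
  = infprod 1 (fun d => local_factor d ^+ N_power F M d).
Proof.
apply/esym/fps_cvg_lim => n; exists n.+1 => k ltnk; rewrite one_add_infsum.
case: k ltnk => // K; rewrite ltnS => lenK.
rewrite -prod_local_factor_deg prod_local_factor_coef //.
case: n lenK => [|n] lenK; last by rewrite card_regular_powers.
rewrite (big_pred1 (npolyp 1 (1 : {poly F}))) => [|P].
  by rewrite npolypK ?size_poly1 // unit_count1 invr1.
have D1 : npolyp 1 (1 : {poly F}) = 1 :> {poly F} by rewrite npolypK ?size_poly1.
apply/and3P/eqP => [[mP sP _] | ->].
  apply: val_inj; rewrite /= D1; have /size_poly1P[c _ Dc] := sP.
  by move: mP; rewrite Dc monicE lead_coefC => /eqP ->.
rewrite D1 monic1 size_poly1; split=> //; apply/asboolP=> f irr_f _.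
by rewrite (negPf (irredp_ndvd1 irr_f)).
Qed.

End EulerProduct.

Section Factors.
Variables (F : finFieldType).
Local Notation u := (fpsX rat).
Local Notation Q := (#|F|%:R : rat).

Lemma regular_regular_in n' (A : 'M[F]_n'.+1) : regular A <-> regular_in predT A.
Proof.
split=> [[D dataD D1] | [D dataD D1]]; exists D => // fl /D1.
  by case: fl.2 => [|k []] // _; exists k.
by case=> k _ ->.
Qed.

Lemma regular_semisimple_in n' (A : 'M[F]_n'.+1) :
  regular_semisimple A <-> regular_in (pred1 1%N) A.
Proof.
split=> [[D dataD D1] | [D dataD D1]]; exists D => // fl /D1.
  by move=> ->; exists 1%N.
by case=> k /eqP -> ->.
Qed.

Lemma GL_rg_powers M n : GL_rg F n M = regular_powers F M predT n.
Proof.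
apply/setP=> g; rewrite !inE; congr (_ && _).
by apply/asboolP/asboolP=> /regular_regular_in.
Qed.

Lemma GL_rs_powers M n : GL_rs F n M = regular_powers F M (pred1 1%N) n.
Proof.
apply/setP=> g; rewrite !inE; congr (_ && _).
by apply/asboolP/asboolP=> /regular_semisimple_in.
Qed.

Lemma fps_sum_multiples (c : nat -> rat) d n : (0 < d)%N ->
  (1 + infsum 1 (fun j => c j *: u ^+ (j * d))) n
  = if (d %| n)%N then (if (n %/ d)%N is 0 then 1 else c (n %/ d)%N) else 0.
Proof.
move=> d0; rewrite fpsDE infsum_coef; last first.
  move=> i m ltmi; rewrite fpsZE fpsXnE ltn_eqF ?mulr0 //.
  by apply: leq_trans ltmi _; rewrite leq_pmulr.
case: n => [|n]; first by rewrite big_nil dvdn0 div0n fps1E addr0.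
rewrite fps1E add0r; case: ifPn => [dn | ndn]; last first.
  rewrite big1 // => j _; rewrite fpsZE fpsXnE.
  by case: eqP => [Dn|_]; [rewrite Dn dvdn_mull in ndn | rewrite mulr0].
have k0 : (0 < n.+1 %/ d)%N by rewrite divn_gt0 // dvdn_leq.
rewrite (bigD1_seq (n.+1 %/ d)%N) ?iota_uniq //; last first.
  by rewrite mem_index_iota k0 ltnS leq_div.
rewrite big1 => [|j nej]; rewrite fpsZE fpsXnE.
  rewrite divnK // eqxx mulr1 [LHS]addr0; by case: (n.+1 %/ d)%N k0.
case: eqP => [Dn|_]; last by rewrite mulr0.
by case/eqP: nej; rewrite Dn mulnK.
Qed.

Lemma local_factor_rs d : (0 < d)%N ->
  local_factor F (pred1 1%N) d = 1 + (Q ^+ d - 1)^-1 *: u ^+ d.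
Proof.
move=> d0; apply: fpsP => n; rewrite local_factorE fpsDE fpsZE fpsXnE fps1E.
have [-> | nd] := eqVneq n d.
  by rewrite dvdnn divnn d0 /= mul1r expr0 mul1r mulr1 gtn_eqF // add0r.
rewrite mulr0 addr0; case: eqP => [-> | n0]; first by rewrite dvdn0 div0n.
case: ifP => // /dvdnP[k Dk]; rewrite Dk mulnK //.
case: k Dk => [|[|k]] Dk; last by rewrite /= mul0r.
  by rewrite mul0n in Dk.
by rewrite Dk mul1n eqxx in nd.
Qed.

Lemma local_factor_rg d : (0 < d)%N ->
  local_factor F predT d
  = 1 + infsum 1 (fun j => (Q ^+ ((j - 1) * d) * (Q ^+ d - 1))^-1 *: u ^+ (j * d)).
Proof.
move=> d0; apply: fpsP => n; rewrite local_factorE fps_sum_multiples //.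
case: ifP => // _; case: (n %/ d)%N => // j.
by rewrite /weight mul1r subn1.
Qed.

(** Summing the geometric series in a local factor. *)
Lemma local_factor_rgE d : (0 < d)%N ->
  local_factor F predT d
  = (1 - (Q ^+ d)^-1 *: u ^+ d)^-1 * (1 + (Q ^+ d * (Q ^+ d - 1))^-1 *: u ^+ d).
Proof.
move=> d0.
have q_gt1 : (1 < #|F| ^ d)%N by rewrite -{1}(exp1n d) ltn_exp2r // card_finNzRing_gt1.
have Qd0 : Q ^+ d != 0 by rewrite -natrX pnatr_eq0 -lt0n ltnW.
have Qd1 : Q ^+ d - 1 != 0 by rewrite subr_eq0 -natrX -[1]/(1%:R) eqr_nat gtn_eqF.
have unit_x : 1 - (Q ^+ d)^-1 *: u ^+ d \is a GRing.unit.
  by rewrite -scaleNr; apply: (@one_mod_unit _ d) => //; apply: one_modZ.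
apply: (mulrI unit_x); rewrite mulVKr // mulrBl mul1r -scalerAl.
apply: fpsP => n; rewrite !(fpsDE, fpsNE, fpsZE) fpsXnM fpsXnE fps1E !local_factorE.
have [ltnd | ledn] := ltnP n d.
  rewrite (ltn_eqF ltnd) !mulr0 subr0 addr0.
  case: n ltnd => [|n] ltnd; first by rewrite dvdn0 div0n.
  by rewrite gtnNdvd.
rewrite dvdn_subl //; case: ifP => [/dvdnP[k Dk] | dn]; last first.
  rewrite mulr0 subrr; case: eqP => [Dn | _]; first by rewrite Dn dvdn0 in dn.
  by case: eqP => [Dn | _]; [rewrite Dn dvdnn in dn | rewrite mulr0 addr0].
have k0 : (0 < k)%N by case: (k) Dk => // Dk; rewrite Dk leqNgt d0 in ledn.
have -> : (n == 0)%N = false by rewrite gtn_eqF // (leq_trans d0).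
rewrite Dk (_ : k * d - d = (k - 1) * d)%N; last by rewrite mulnBl mul1n.
rewrite (_ : (k * d == d)%N = (k == 1)%N); last by rewrite -{2}[d]mul1n eqn_pmul2r.
rewrite !mulnK //.
case: k k0 Dk => [//|[|k]] _ _; rewrite subn1 /= ?mul1r ?add0r.
  by rewrite !mulr1; field; rewrite Qd0 Qd1.
rewrite mulr0 mulSn exprD -[in X in _ - X]invfM mulrA subrr //.
Qed.

End Factors.

Theorem theorem5p3 (M q : nat) (F : finFieldType)
    (hM : (2 <= M)%N) (hq : #|F| = q) (hqM : coprime q M) :
  let u := fpsX rat in
  let Q : rat := q%:R in
  let N := N_power F M in
  (1 + infsum 1 (fun n => (#|GL_rs F n M|%:R / #|'GL_n[F]%g|%:R) *: u ^+ n)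
     = infprod 1 (fun d => (1 + (Q ^+ d - 1)^-1 *: u ^+ d) ^+ N d))
  /\
  (1 + infsum 1 (fun n => (#|GL_rg F n M|%:R / #|'GL_n[F]%g|%:R) *: u ^+ n)
     = infprod 1 (fun d =>
         (1 + infsum 1 (fun j =>
                (Q ^+ ((j - 1) * d) * (Q ^+ d - 1))^-1 *: u ^+ (j * d))) ^+ N d)
   /\
   infprod 1 (fun d =>
         (1 + infsum 1 (fun j =>
                (Q ^+ ((j - 1) * d) * (Q ^+ d - 1))^-1 *: u ^+ (j * d))) ^+ N d)
     = infprod 1 (fun d => (1 - (Q ^+ d)^-1 *: u ^+ d) ^- N d)
       * infprod 1 (fun d => (1 + (Q ^+ d * (Q ^+ d - 1))^-1 *: u ^+ d) ^+ N d)).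
Proof.
move=> u Q N; have M0 : (0 < M)%N by exact: ltnW.
rewrite /Q -hq in hqM *.
have rg_eq : infprod 1 (fun d => local_factor F predT d ^+ N d) =
  infprod 1 (fun d => (1 + infsum 1 (fun j =>
    (#|F|%:R ^+ ((j - 1) * d) * (#|F|%:R ^+ d - 1))^-1 *: u ^+ (j * d))) ^+ N d).
  by apply: eq_infprod => d d0; rewrite local_factor_rg.
split; [|split].
- rewrite (_ : infprod 1 _ = infprod 1 (fun d => local_factor F (pred1 1%N) d ^+ N d)).
    rewrite -euler_product //; congr (_ + infsum 1 _); apply/funext => n.
    by rewrite GL_rs_powers.
  by apply: eq_infprod => d d0; rewrite local_factor_rs.
- rewrite -rg_eq -euler_product //; congr (_ + infsum 1 _); apply/funext => n.
  by rewrite GL_rg_powers.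
rewrite -rg_eq -infprodM; first last.
- by move=> d d0; apply/one_modX/one_modZ.
- by move=> d d0; rewrite -exprVn -scaleNr; apply/one_modX/one_modV/one_modZ.
apply: eq_infprod => d d0.
by rewrite local_factor_rgE // exprMn exprVn.
Qed.
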